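(* Let $d\ge 1$ be an integer and let $a^H:\mathbb{Z}^d\to\mathbb{C}$ be the $d$-dimensional Haar low-pass filter, i.e. $a^H(k)=2^{-d}$ if $k\in\{0,1\}^d$ and $a^H(k)=0$ otherwise. Let $s:=\binom{2^d}{2}=2^{d-1}(2^d-1)$, and let $b_1,\ldots,b_s$ be the filters $2^{-d}(\boldsymbol{\delta}_{\gamma_1}-\boldsymbol{\delta}_{\gamma_2})$, one for each unordered pair $\{\gamma_1,\gamma_2\}$ of distinct points of $\{0,1\}^d$ (the ordering of the two points in each pair being chosen arbitrarily). Then: (1) $\{a^H;b_1,\ldots,b_s\}$ is a $d$-dimensional dyadic tight framelet filter bank. (2) All the high-pass filters $b_1,\ldots,b_s$ have directionality, and together they exhibit exactly $\frac12(3^d-1)$ distinct directions. (3) Define $\phi,\psi_1,\ldots,\psi_s$ by $$\widehat{\phi}(\xi):=\prod_{j=1}^\infty\widehat{a^H}(2^{-j}\xi),\qquad \widehat{\psi_\ell}(\xi):=\widehat{b_\ell}(\xi/2)\,\widehat{\phi}(\xi/2),\qquad \xi\in\mathbb{R}^d,\ \ell=1,\ldots,s.$$ Then $\phi,\psi_1,\ldots,\psi_s$ are compactly supported functions in $L_2(\mathbb{R}^d)$ and $\{\phi;\psi_1,\ldots,\psi_s\}$ is a (directional, Haar) tight framelet in $L_2(\mathbb{R}^d)$.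
   Context: A (finitely supported) filter on $\mathbb{Z}^d$ is a finitely supported function $a:\mathbb{Z}^d\to\mathbb{C}$. Its Fourier series is $\widehat{a}(\xi):=\sum_{k\in\mathbb{Z}^d}a(k)e^{-ik\cdot\xi}$, $\xi\in\mathbb{R}^d$. For $\gamma\in\mathbb{Z}^d$, $\boldsymbol{\delta}_\gamma$ is the filter with $\boldsymbol{\delta}_\gamma(\gamma)=1$ and $\boldsymbol{\delta}_\gamma(k)=0$ for $k\ne\gamma$; $\boldsymbol{\delta}:=\boldsymbol{\delta}_0$. For functions, the Fourier transform is $\widehat{f}(\xi)=\int_{\mathbb{R}^d}f(x)e^{-ix\cdot\xi}\,dx$, extended to $L_2(\mathbb{R}^d)$ and to tempered distributions in the usual way. Tight framelet filter bank: finitely supported filters $\{a;b_1,\ldots,b_s\}$ on $\mathbb{Z}^d$ form a $d$-dimensional dyadic tight framelet filter bank if $$\widehat{a}(\xi)\overline{\widehat{a}(\xi+\pi\omega)}+\sum_{\ell=1}^s\widehat{b_\ell}(\xi)\overline{\widehat{b_\ell}(\xi+\pi\omega)}=\boldsymbol{\delta}(\omega)\qquad\text{for all }\xi\in\mathbb{R}^d,\ \omega\in\{0,1\}^d.$$ The filter $a$ is called the low-pass filter and $b_1,\ldots,b_s$ the high-pass filters. Tight framelet: $\{\phi;\psi_1,\ldots,\psi_s\}\subset L_2(\mathbb{R}^d)$ is a (nonhomogeneous) tight framelet in $L_2(\mathbb{R}^d)$ if for all $f\in L_2(\mathbb{R}^d)$ $$\|f\|_{L_2(\mathbb{R}^d)}^2=\sum_{k\in\mathbb{Z}^d}|\langle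 f,\phi(\cdot-k)\rangle|^2+\sum_{j=0}^\infty\sum_{\ell=1}^s\sum_{k\in\mathbb{Z}^d}|\langle f,2^{jd/2}\psi_\ell(2^j\cdot-k)\rangle|^2.$$ Directionality: a filter has directionality here in the sense that it has exactly two nonzero coefficients, and these have opposite signs. The direction of a filter $c(\boldsymbol{\delta}_{\gamma_1}-\boldsymbol{\delta}_{\gamma_2})$, $c\neq0$, $\gamma_1\ne\gamma_2$, is the (undirected) direction represented by the vector $\gamma_1-\gamma_2$, or equivalently $\gamma_2-\gamma_1$; for points of $\{0,1\}^d$, two such vectors represent the same direction exactly when they agree up to sign. A tight framelet is called directional when its high-pass filters have directionality, and ''Haar'' refers to its low-pass filter being $a^H$. *)

(* Defs.v *)
From HB Require Import structures.
From mathcomp Require Import all_boot all_order all_algebra.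
From mathcomp Require Import complex.
From mathcomp Require Import all_classical all_reals all_analysis.

Set Implicit Arguments.
Unset Strict Implicit.
Unset Printing Implicit Defensive.

Import Order.TTheory GRing.Theory Num.Theory.
Import numFieldNormedType.Exports.

Local Open Scope classical_set_scope.
Local Open Scope ring_scope.
Local Open Scope complex_scope.

(* The library has no measure on R^d for general d.  Row vectors 'rV[R]_d get
   the sigma-algebra generated by the coordinates (the Borel sigma-algebra of
   R^d), exactly as the library does for tuples. *)

Definition rV_display : measure_display -> measure_display.
Proof. exact. Qed.

Section measurable_rV.
Context {R : realType}.
Variable n : nat.

Definition rV_coord (i : 'I_n) (x : 'rV[R]_n) : R := x 0 i.

Let rV_set0 : g_sigma_preimage rV_coord set0.
Proof. exact: sigma_algebra0. Qed.

Let rV_setC A : g_sigma_preimage rV_coord A -> g_sigma_preimage rV_coord (~` A).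
Proof. exact: sigma_algebraC. Qed.

Let rV_bigcup (F : _^nat) : (forall i, g_sigma_preimage rV_coord (F i)) ->
  g_sigma_preimage rV_coord (\bigcup_i (F i)).
Proof. exact: sigma_algebra_bigcup. Qed.

HB.instance Definition _ := @isMeasurable.Build (rV_display default_measure_display)
  ('rV[R]_n) (g_sigma_preimage rV_coord) rV_set0 rV_setC rV_bigcup.

Lemma measurable_rV_coord i : measurable_fun [set: 'rV[R]_n] (rV_coord i).
Proof.
move=> _ Y mY; rewrite setTI; apply: sub_sigma_algebra => /=.
rewrite -bigcup_seq/=; exists i => /=; first by rewrite mem_index_enum.
by exists Y => //; rewrite setTI.
Qed.

Lemma measurable_fun_rVP d (T : measurableType d) (f : T -> 'rV[R]_n) :
  (forall i, measurable_fun [set: T] (rV_coord i \o f)) ->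
  measurable_fun [set: T] f.
Proof.
move=> mf _ A mA; rewrite setTI.
have : (g_sigma_preimage (fun i => rV_coord i \o f)) `<=` measurable.
  apply: smallest_sub; first exact: sigma_algebra_measurable.
  rewrite -bigcup_seq => B [i _ [C mC <-]]; exact: mf.
by apply; rewrite g_sigma_preimage_comp; exists A => //; rewrite setTI.
Qed.

End measurable_rV.

Section lebesgue_rV.
Context {R : realType}.

Definition rV_cons n (p : R * 'rV[R]_n) : 'rV[R]_n.+1 :=
  \row_i (if unlift ord0 i is Some j then p.2 0 j else p.1).

Definition rV_uncons n (x : 'rV[R]_n.+1) : R * 'rV[R]_n :=
  (x 0 ord0, \row_j x 0 (lift ord0 j)).

Lemma rV_consK n : cancel (@rV_cons n) (@rV_uncons n).
Proof.
case=> a v; rewrite /rV_uncons /rV_cons mxE unlift_none; congr pair.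
by apply/rowP => j; rewrite !mxE liftK.
Qed.

Lemma measurable_rV_cons n :
  measurable_fun [set: measurableTypeR R * 'rV[R]_n] (@rV_cons n).
Proof.
apply: measurable_fun_rVP => i.
case: (unliftP ord0 i) => [j ->|->].
- rewrite (_ : _ \o _ = rV_coord j \o snd).
    by apply: measurableT_comp; [exact: measurable_rV_coord|exact: measurable_snd].
  by apply/funext => p /=; rewrite /rV_coord mxE liftK.
- rewrite (_ : _ \o _ = fst); first exact: measurable_fst.
  by apply/funext => p /=; rewrite /rV_coord mxE unlift_none.
Qed.

Lemma measurable_rV_uncons n :
  measurable_fun [set: 'rV[R]_n.+1]
    (@rV_uncons n : _ -> measurableTypeR R * 'rV[R]_n).
Proof.
apply: measurable_fun_pair; first exact: measurable_rV_coord.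
apply: measurable_fun_rVP => i.
rewrite (_ : _ \o _ = rV_coord (lift ord0 i)); first exact: measurable_rV_coord.
by apply/funext => x; rewrite /rV_coord /= mxE.
Qed.

Section step.
Local Open Scope ereal_scope.
Variables (n : nat) (m : {sigma_finite_measure set 'rV[R]_n -> \bar R}).

Definition lebesgue_rVS : set 'rV[R]_n.+1 -> \bar R :=
  pushforward (@lebesgue_measure R \x m) (@rV_cons n).

Let m0 : lebesgue_rVS set0 = 0.
Proof. by rewrite /lebesgue_rVS /pushforward preimage_set0 measure0. Qed.

Let m_ge0 A : 0 <= lebesgue_rVS A.
Proof. by rewrite /lebesgue_rVS /pushforward; exact: measure_ge0. Qed.

Let mcons A : measurable A -> measurable (@rV_cons n @^-1` A).
Proof. by move=> mA; rewrite -[X in measurable X]setTI; exact: measurable_rV_cons. Qed.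

Let m_sigma_additive : semi_sigma_additive lebesgue_rVS.
Proof.
move=> F mF tF mUF; rewrite /lebesgue_rVS /pushforward preimage_bigcup.
apply: measure_semi_sigma_additive.
- by move=> k; exact: mcons.
- apply/trivIsetP => /= i j _ _ ij; rewrite -preimage_setI.
  by move/trivIsetP : tF => /(_ _ _ _ _ ij) ->//; rewrite preimage_set0.
- by rewrite -preimage_bigcup; exact: mcons.
Qed.

HB.instance Definition _ := isMeasure.Build _ _ _
  lebesgue_rVS m0 m_ge0 m_sigma_additive.

Let m_sigma_finite : sigma_finite setT lebesgue_rVS.
Proof.
have [F FT Foo] : sigma_finite setT (@lebesgue_measure R \x m).
  have /sigma_finiteP[F [TF ndF Foo]] := sigma_finiteT (@lebesgue_measure R).
  have /sigma_finiteP[G [TG ndG Goo]] := sigma_finiteT m.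
  exists (fun k => F k `*` G k).
    rewrite -setXTT TF TG predeqE => -[x y]; split.
      move=> [/= [k _ Fnx] [l _ Gky]]; exists (maxn k l) => //; split.
      - by move: x Fnx; exact/subsetPset/ndF/leq_maxl.
      - by move: y Gky; exact/subsetPset/ndG/leq_maxr.
    by move=> [k _ []/= ? ?]; split; exists k.
  move=> k; have [? ?] := Foo k; have [? ?] := Goo k.
  split; first exact: measurableX.
  by rewrite product_measure1E// lte_mul_pinfty// ge0_fin_numE.
exists (fun k => @rV_uncons n @^-1` F k).
  by rewrite -preimage_bigcup -FT preimage_setT.
move=> k; have [mF Fk] := Foo k; split.
  by rewrite -[X in measurable X]setTI; exact: measurable_rV_uncons.
rewrite /lebesgue_rVS /pushforward -comp_preimage.
rewrite (_ : _ @^-1` _ = F k)//.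
by apply/seteqP; split => x /=; rewrite rV_consK.
Qed.

HB.instance Definition _ := Measure_isSigmaFinite.Build _ _ _
  lebesgue_rVS m_sigma_finite.

End step.

(* d-dimensional Lebesgue measure, as an iterated product. *)
Fixpoint lebesgue_rV (d : nat) : {sigma_finite_measure set 'rV[R]_d -> \bar R} :=
  if d is n.+1 then lebesgue_rVS (lebesgue_rV n) else \d_(0 : 'rV[R]_0).

Lemma lebesgue_rV_box d (A : 'I_d -> set (measurableTypeR R)) :
  (forall i, measurable (A i)) ->
  lebesgue_rV d [set x | forall i, A i (x 0 i)] =
  (\prod_(i < d) lebesgue_measure (A i))%E.
Proof.
elim: d A => [|d IH] A mA.
  rewrite big_ord0 /= diracE mem_set//; by case.
rewrite big_ord_recl -IH//= /lebesgue_rVS /pushforward.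
have -> : @rV_cons d @^-1` [set x | forall i, A i (x 0 i)] =
    A ord0 `*` [set x : 'rV[R]_d | forall i, A (lift ord0 i) (x 0 i)].
  apply/seteqP; split=> -[a v] /=.
    move=> H; split; first by have := H ord0; rewrite mxE unlift_none.
    by move=> i; have := H (lift ord0 i); rewrite mxE liftK.
  case=> /= H0 H i; rewrite mxE.
  by case: unliftP => [j ->|->].
rewrite product_measure1E//.
rewrite (_ : mkset _ = \bigcap_(i in [set: 'I_d]) (rV_coord i @^-1` A (lift ord0 i))).
  apply: fin_bigcap_measurable => // i _.
  have mAi : @measurable _ R (A (lift ord0 i)) by exact: mA.
  have := @measurable_rV_coord R d i measurableT _ mAi.
  by rewrite setTI.
by apply/seteqP; split=> x /= H i; [move=> _; exact: H|exact: (H i)].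
Qed.

End lebesgue_rV.

Lemma bin_pow2_2 d : (0 < d)%N -> 'C(2 ^ d, 2) = (2 ^ d.-1 * (2 ^ d - 1))%N.
Proof.
case: d => // d _; rewrite bin2 subn1 /=.
by rewrite [X in (X * _)./2]expnS -mulnA mul2n doubleK.
Qed.

Section filters.
Variables (R : realType) (d : nat).
Implicit Types (a : 'rV[int]_d -> R[i]) (k g w : 'rV[int]_d) (x xi : 'rV[R]_d).

Definition toRd k : 'rV[R]_d := map_mx intr k.

Definition dot x xi : R := \sum_(i < d) x 0 i * xi 0 i.

Definition expi (t : R) : R[i] := cos t +i* sin t.

Definition finitely_supported a := finite_set [set k | a k != 0].

(* A sum over a set is a junk value when its support is infinite; it is only
   used for finitely supported filters. *)
Definition fourier_series a xi : R[i] :=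
  \sum_(k \in [set: 'rV[int]_d]) a k * expi (- dot (toRd k) xi).

Definition delta g : 'rV[int]_d -> R[i] := fun k => (k == g)%:R.

Definition cube01 : set 'rV[int]_d := [set k | forall i, k 0 i = 0 \/ k 0 i = 1].

Definition tight_framelet_filter_bank s a (b : 'I_s -> 'rV[int]_d -> R[i]) :=
  [/\ finitely_supported a,
      forall l, finitely_supported (b l) &
      forall xi w, cube01 w ->
        fourier_series a xi * (fourier_series a (xi + pi *: toRd w))^* +
        \sum_(l < s) fourier_series (b l) xi *
                     (fourier_series (b l) (xi + pi *: toRd w))^*
        = delta 0 w].

Definition haar_lowpass : 'rV[int]_d -> R[i] :=
  fun k => if k \in cube01 then (2 ^+ d)^-1 else 0.

Definition haar_highpass g1 g2 : 'rV[int]_d -> R[i] :=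
  fun k => (2 ^+ d)^-1 * (delta g1 k - delta g2 k).

(* l |-> {g1 l, g2 l} lists every unordered pair of distinct points of the cube
   exactly once; which point of a pair is g1 l and which is g2 l is arbitrary. *)
Definition enumerates_pairs s (g1 g2 : 'I_s -> 'rV[int]_d) :=
  (forall l, [/\ cube01 (g1 l), cube01 (g2 l) & g1 l <> g2 l]) /\
  (forall u v, cube01 u -> cube01 v -> u <> v ->
     exists! l, (g1 l = u /\ g2 l = v) \/ (g1 l = v /\ g2 l = u)).

(* In R[i], 0 < z means that z is real and positive. *)
Definition has_directionality a :=
  exists g1 g2, [/\ 0 < a g1, a g2 < 0 &
    forall k, k <> g1 -> k <> g2 -> a k = 0].

(* An undirected direction is a line through the origin. *)
Definition direction_of k : set 'rV[R]_d := [set t *: toRd k | t in [set: R]].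

Definition filter_direction a (D : set 'rV[R]_d) :=
  exists c g1 g2, [/\ c != 0, g1 <> g2,
    a = (fun k => c * (delta g1 k - delta g2 k)) & D = direction_of (g1 - g2)].

Definition directions s (b : 'I_s -> 'rV[int]_d -> R[i]) : set (set 'rV[R]_d) :=
  [set D | exists l, filter_direction (b l) D].

End filters.
Arguments haar_lowpass : clear implicits.

Section functions.
Variables (R : realType) (d : nat).
Implicit Types (f g phi : 'rV[R]_d -> R[i]).
Notation mu := (lebesgue_rV d).

Definition cmeasurable f :=
  measurable_fun [set: 'rV[R]_d] (fun x => complex.Re (f x)) /\
  measurable_fun [set: 'rV[R]_d] (fun x => complex.Im (f x)).

(* Meaningful when the real and imaginary parts of f are integrable. *)
Definition cintegral f : R[i] :=
  (\int[mu]_x complex.Re (f x)) +i* (\int[mu]_x complex.Im (f x)).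

Definition norm2sq f : \bar R :=
  (\int[mu]_x (ComplexField.Normc.normc (f x) ^+ 2)%:E)%E.

Definition in_L2 f := cmeasurable f /\ (norm2sq f < +oo)%E.

Definition inner f g : R[i] := cintegral (fun x => f x * (g x)^*).

Definition fourier f (xi : 'rV[R]_d) : R[i] :=
  cintegral (fun x => f x * expi (- dot x xi)).

Definition compactly_supported f := compact (closure [set x | f x != 0]).

Definition translate phi (k : 'rV[int]_d) : 'rV[R]_d -> R[i] :=
  fun x => phi (x - toRd R k).

Definition dilate_shift phi (j : nat) (k : 'rV[int]_d) : 'rV[R]_d -> R[i] :=
  fun x => (2 `^ ((j * d)%:R / 2))%:C * phi (2 ^+ j *: x - toRd R k).

Definition tight_framelet s phi (psi : 'I_s -> 'rV[R]_d -> R[i]) :=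
  [/\ in_L2 phi, forall l, in_L2 (psi l) &
      forall f, in_L2 f ->
        norm2sq f =
        (\esum_(k in [set: 'rV[int]_d])
            (ComplexField.Normc.normc (inner f (translate phi k)) ^+ 2)%:E +
         \sum_(0 <= j <oo) \sum_(l < s) \esum_(k in [set: 'rV[int]_d])
            (ComplexField.Normc.normc (inner f (dilate_shift (psi l) j k)) ^+ 2)%:E)%E].

End functions.

(* Main.v *)
(* Everything rests on one identity: for c defined on the 2^d vertices of the cube,
   |sum_u c_u|^2 + sum |c_u - c_v|^2 = 2^d sum_u |c_u|^2, where the second sum
   runs over the unordered pairs of vertices.
   Polarised and applied to the characters u |-> e^{-iu.xi}, it gives the filter
   bank by orthogonality of characters.  For (3) take phi = 1_[0,1)^d, so that
   psi_l(x) = phi(2x - gamma_1) - phi(2x - gamma_2).  The refinement equation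
   yields phi^(xi) = prod_{j<=n} a^(2^-j xi) phi^(2^-n xi), where the partial
   products are bounded by 1 and phi^(2^-n xi) -> 1.  Let E_n(f) be the sum over
   the dyadic cubes Q of level n of |int_Q f|^2 / |Q|.  The identity above, applied
   to the children of each cube, says that E_{n+1} - E_n is exactly the level-n
   wavelet energy, so the framelet identity telescopes to E_n(f) -> |f|^2.  That
   limit is the density of dyadic step functions in L2; it is proved without
   constructing projections, because |f|^2 - E_n(f) is a nonnegative quadratic
   form that decreases with n. *)
Require Import Defs.
From mathcomp Require Import all_boot all_order all_algebra.
From mathcomp Require Import complex.
From mathcomp Require Import all_classical all_reals all_analysis.
From mathcomp Require Import measurable_realfun.
From mathcomp Require Import zify ring lra.

Set Implicit Arguments.
Unset Strict Implicit.
Unset Printing Implicit Defensive.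

Import Order.TTheory GRing.Theory Num.Theory.
Import numFieldNormedType.Exports.

Local Open Scope classical_set_scope.
Local Open Scope ring_scope.
Local Open Scope complex_scope.

(** * Pairs of cube vertices *)

Section cube.
Variable d : nat.
Implicit Types (u v : {ffun 'I_d -> bool}).

(** The form |f|^2 - E_n(f) can replace a projection because three properties suffice. The
    parallelogram law bounds its value at u + v by twice the sum of the values at u and v;
    monotonicity in n merges two levels into the finer one; the bound by |f|^2 carries smallness
    over to L2 limits. The functions on which it tends to 0 therefore form a closed subspace, and
    indicators of measurable sets of finite measure are enough. For these, dyadic cubes serve as a
    pi-system that generates the Borel sets. Complements must keep finite measure, so the Dynkin
    induction runs inside one unit cube at a time. The same pi-system identifies the image of
    Lebesgue measure under x -> 2x - k. Since phi and the wavelets are real, inner products split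
    into real and imaginary parts, and energies are studied for real functions only. The number (3^d
    - 1)/2 arises because the differences of distinct vertices are exactly the nonzero vectors of
    {-1,0,1}^d, two of which are parallel only if they agree up to sign. *)

Definition cube_pt u : 'rV[int]_d := \row_i (u i : nat)%:Z.

Lemma cube_pt_inj : injective cube_pt.
Proof.
move=> u v /rowP uv; apply/ffunP => i; have := uv i; rewrite !mxE => -[].
by case: (u i) (v i) => [] [].
Qed.

Lemma cube01_pt u : cube01 (cube_pt u).
Proof. by move=> i; rewrite mxE; case: (u i); [right|left]. Qed.

Lemma cube01P k : cube01 k -> exists u, k = cube_pt u.
Proof.
move=> kc; exists [ffun i => k 0 i == 1]; apply/rowP => i; rewrite mxE ffunE.
by case: (kc i) => ->.
Qed.

Lemma card_cube : #|{: {ffun 'I_d -> bool}}| = (2 ^ d)%N.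
Proof. by rewrite card_ffun card_bool card_ord. Qed.

Section pairs.
Variables (s : nat) (g1 g2 : 'I_s -> 'rV[int]_d).
Hypothesis g_pairs : enumerates_pairs g1 g2.

(** Symmetrising the summand removes the arbitrary order inside each pair and turns the enumeration
    into a sum over ordered pairs. *)
Lemma sum_enum_pairs (V : nmodType) (F : 'rV[int]_d -> 'rV[int]_d -> V) :
  \sum_(l < s) (F (g1 l) (g2 l) + F (g2 l) (g1 l)) =
  \sum_u \sum_(v | u != v) F (cube_pt u) (cube_pt v).
Proof.
have [gc gu] := g_pairs.
have /choice[u1 u1E] l : exists u, g1 l = cube_pt u.
  by have [+ _ _] := gc l => /cube01P.
have /choice[u2 u2E] l : exists u, g2 l = cube_pt u.
  by have [_ + _] := gc l => /cube01P.
have u12 l : u1 l != u2 l.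
  by have [_ _] := gc l; apply: contra_not_neq => e; rewrite u1E u2E e.
(* [m l p] says that [p] is one of the two orderings of pair [l]. The incidences are counted twice:
   each ordered pair of distinct vertices meets one [l], each [l] meets two ordered pairs. *)
pose m l (p : {ffun 'I_d -> bool} * {ffun 'I_d -> bool}) :=
  (p == (u1 l, u2 l)) || (p == (u2 l, u1 l)).
rewrite pair_big_dep/=.
transitivity (\sum_(p | p.1 != p.2) \sum_(l < s | m l p)
    F (cube_pt p.1) (cube_pt p.2)); last first.
  apply: eq_bigr => -[u v] /= uv.
  have [l [lE lU]] := gu _ _ (cube01_pt u) (cube01_pt v)
    (fun e => negP uv (introT eqP (cube_pt_inj e))).
  apply: big_pred1 => l'; apply/idP/eqP => [|->].
    move=> ml; apply/esym/lU; move: ml => /orP[]/eqP[-> ->].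
      by left.
    by right.
  rewrite /m !u1E !u2E in lE *.
  case: lE => -[/cube_pt_inj -> /cube_pt_inj ->]; by rewrite eqxx ?orbT.
rewrite (exchange_big_dep xpredT)//=; apply: eq_bigr => l _.
rewrite (bigD1 (u1 l, u2 l))/=; last by rewrite u12 /m eqxx.
rewrite -u1E -u2E; congr (_ + _).
rewrite (big_pred1 (u2 l, u1 l)) -?u1E -?u2E//= => -[u v] /=.
rewrite /m; apply/idP/eqP => [|[-> ->]].
  by move=> /andP[/andP[_ /orP[/eqP->|/eqP//]]]; rewrite eqxx.
by rewrite eq_sym u12 eqxx orbT/= xpair_eqE negb_and eq_sym u12.
Qed.

(* Polarised form of N sum |f u|^2 = |sum f u|^2 + sum_{u<v} |f u - f v|^2. *)
Lemma sum_enum_pairs_sub (K : numFieldType) (f g : 'rV[int]_d -> K) :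
  (\sum_u f (cube_pt u)) * (\sum_u g (cube_pt u)) +
  \sum_(l < s) (f (g1 l) - f (g2 l)) * (g (g1 l) - g (g2 l)) =
  2 ^+ d * \sum_u f (cube_pt u) * g (cube_pt u).
Proof.
(* Doubling makes every unordered pair count in both orders, as [sum_enum_pairs] requires. *)
apply: (@mulfI _ 2); first by rewrite pnatr_eq0.
rewrite mulrDr [X in _ + X]mulr_sumr.
have -> : \sum_(l < s) 2 * ((f (g1 l) - f (g2 l)) * (g (g1 l) - g (g2 l))) =
    \sum_(l < s) ((f (g1 l) - f (g2 l)) * (g (g1 l) - g (g2 l)) +
      (f (g2 l) - f (g1 l)) * (g (g2 l) - g (g1 l))).
  by apply: eq_bigr => l _; ring.
rewrite (sum_enum_pairs (fun x y => (f x - f y) * (g x - g y))).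
(* The diagonal terms vanish, so [v] may range over all vertices and the double sum factors. *)
have -> : \sum_u \sum_(v | u != v) (f (cube_pt u) - f (cube_pt v)) *
      (g (cube_pt u) - g (cube_pt v)) =
    \sum_u \sum_v (f (cube_pt u) * g (cube_pt u) +
      f (cube_pt v) * g (cube_pt v) - f (cube_pt u) * g (cube_pt v) -
      g (cube_pt u) * f (cube_pt v)).
  apply: eq_bigr => u _; rewrite big_mkcond; apply: eq_bigr => v _.
  by case: eqVneq => [<-|_] /=; ring.
under [X in _ + X]eq_bigr => u _.
  rewrite !sumrB big_split/= sumr_const card_cube -!mulr_sumr.
  over.
rewrite !sumrB big_split/= sumr_const card_cube -!mulr_suml.
rewrite sumrMnl.
rewrite -natrX; set A := \sum_i _ * _; set B := \sum_i f _; set C := \sum_i g _.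
move: A B C (2 ^ d)%N => A B C N.
by rewrite -(mulr_natl A); ring.
Qed.

End pairs.
End cube.

(** * Fourier series of filters supported on the cube *)

Section fourier_series.
Variables (R : realType) (d : nat).
Implicit Types (a : 'rV[int]_d -> R[i]) (t : R) (xi : 'rV[R]_d).

Lemma expi0 : expi 0 = 1 :> R[i].
Proof. by rewrite /expi cos0 sin0. Qed.

Lemma expiD t t' : expi (t + t') = expi t * expi t'.
Proof. by rewrite /expi cosD sinD addrC [sin t * _ + _]addrC addrC. Qed.

Lemma expi_pi : expi pi = -1 :> R[i].
Proof. by rewrite /expi cospi sinpi; apply/eqP; rewrite eq_complex/= oppr0 !eqxx. Qed.

Lemma expi_sum (I : finType) (F : I -> R) :
  expi (\sum_i F i) = \prod_i expi (F i).
Proof. exact: (big_morph _ expiD expi0). Qed.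

Lemma conj_expi t : Num.conj (expi t) = expi (- t) :> R[i].
Proof. by rewrite /expi cosN sinN. Qed.

Lemma norm_expi t : `|expi t| = 1.
Proof. by rewrite normc_def /= cos2Dsin2 sqrtr1. Qed.

Lemma fourier_series_cube a xi :
  (forall k, ~ cube01 k -> a k = 0) ->
  fourier_series a xi =
  \sum_u a (cube_pt u) * expi (- dot (toRd R (cube_pt u)) xi).
Proof.
move=> a0; rewrite /fourier_series.
rewrite -(@fsbig_widen _ _ _ _ (range (@cube_pt d)))//=; last first.
  move=> k [_ /= kc]; rewrite a0 ?mul0r// => /cube01P[u ku].
  by apply: kc; exists u.
rewrite fsbig_image; last by move=> u v _ _; exact: cube_pt_inj.
by rewrite (fsbig_fwiden (index_enum _)) ?index_enum_uniq//= => u;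
  rewrite /= ?mem_index_enum//; case.
Qed.

End fourier_series.

(** * The Haar filter bank and the direction of a single filter *)

Section filter_bank.
Variables (R : realType) (d : nat).
Implicit Types (a : 'rV[int]_d -> R[i]) (t : R) (x xi : 'rV[R]_d) (k : 'rV[int]_d).

Lemma dotDr x xi xi' : dot x (xi + xi') = dot x xi + dot x xi'.
Proof. by rewrite /dot -big_split/=; apply: eq_bigr => i _; rewrite mxE mulrDr. Qed.

Lemma dotDl x x' xi : dot (x + x') xi = dot x xi + dot x' xi.
Proof. by rewrite /dot -big_split/=; apply: eq_bigr => i _; rewrite mxE mulrDl. Qed.

Lemma dotZr t x xi : dot x (t *: xi) = t * dot x xi.
Proof. by rewrite /dot mulr_sumr; apply: eq_bigr => i _; rewrite mxE mulrCA. Qed.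

Lemma dotZl t x xi : dot (t *: x) xi = t * dot x xi.
Proof. by rewrite /dot mulr_sumr; apply: eq_bigr => i _; rewrite mxE mulrA. Qed.

(** The frequency [xi] cancels, and the sum over vertices factors over the coordinates into the
    product of the 1 + e^{i pi w_i}. Each factor is 2 if w_i = 0 and 0 if w_i = 1. *)
Lemma cube_character_orthogonality xi w : cube01 w ->
  \sum_u expi (- dot (toRd R (cube_pt u)) xi) *
    Num.conj (expi (- dot (toRd R (cube_pt u)) (xi + pi *: toRd R w))) =
  2 ^+ d * delta R 0 w :> R[i].
Proof.
move=> wc.
transitivity (\sum_(u : {ffun 'I_d -> bool})
    \prod_i (expi ((u i)%:R * (pi * (w 0 i)%:~R)) : R[i])).
  apply: eq_bigr => u _; rewrite conj_expi opprK -expiD dotDr addrA addNr add0r.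
  rewrite /dot expi_sum; apply: eq_bigr => i _; rewrite !mxE -mulrzr mul1r //.
rewrite -(bigA_distr_bigA (fun i (b : bool) => expi (b%:R * (pi * (w 0 i)%:~R)))).
under eq_bigr do rewrite big_bool/= mul1r mul0r expi0.
rewrite /delta; have [->|w0] := eqVneq w 0.
  rewrite (eq_bigr (fun=> 2)) => [|i _]; last by rewrite mxE mulr0 expi0.
  by rewrite prodr_const card_ord mulr1.
have [i wi] : exists i, w 0 i != 0.
  by apply/existsP; apply: contraNT w0 => /existsPn w0; apply/eqP/rowP => i;
    rewrite mxE; apply/eqP/negPn/w0.
rewrite mulr0 (bigD1 i)//=; have [w0i|->] := wc i; first by rewrite w0i eqxx in wi.
by rewrite mulr1 expi_pi addNr mul0r.
Qed.

Lemma finitely_supported_cube a :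
  (forall k, ~ cube01 k -> a k = 0) -> finitely_supported a.
Proof.
move=> a0; apply: (@sub_finite_set _ _ (range (@cube_pt d))); last first.
  by apply: finite_image; exact: finite_finset.
move=> k /= ak; have [|u ->] := @cube01P _ k; last by exists u.
by apply: contrapT => /a0 ak0; rewrite ak0 eqxx in ak.
Qed.

Lemma haar_lowpass_cube k : ~ cube01 k -> haar_lowpass R d k = 0.
Proof. by rewrite /haar_lowpass; case: ifPn => //; rewrite inE. Qed.

Lemma haar_highpass_cube (g1 g2 : 'rV[int]_d) k : cube01 g1 -> cube01 g2 ->
  ~ cube01 k -> haar_highpass R g1 g2 k = 0.
Proof.
move=> c1 c2 kc; rewrite /haar_highpass /delta.
have /negPf-> : k != g1 by apply: contra_notN kc => /eqP->.
have /negPf-> : k != g2 by apply: contra_notN kc => /eqP->.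
by rewrite subrr mulr0.
Qed.

Lemma fourier_haar_lowpass xi : fourier_series (haar_lowpass R d) xi =
  (2 ^+ d)^-1 * \sum_u expi (- dot (toRd R (cube_pt u)) xi).
Proof.
rewrite fourier_series_cube; last exact: haar_lowpass_cube.
rewrite mulr_sumr; apply: eq_bigr => u _.
by rewrite /haar_lowpass mem_set//; exact: cube01_pt.
Qed.

Lemma fourier_haar_highpass (g1 g2 : 'rV[int]_d) xi : cube01 g1 -> cube01 g2 ->
  fourier_series (haar_highpass R g1 g2) xi =
  (2 ^+ d)^-1 * (expi (- dot (toRd R g1) xi) - expi (- dot (toRd R g2) xi)).
Proof.
move=> c1 c2; rewrite fourier_series_cube; last first.
  by move=> k; exact: haar_highpass_cube.
have deltaE g : cube01 g -> \sum_u delta R g (cube_pt u) *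
    expi (- dot (toRd R (cube_pt u)) xi) = expi (- dot (toRd R g) xi).
  move=> /cube01P[v ->]; rewrite (bigD1 v)//= /delta eqxx mul1r big1 ?addr0//.
  by move=> u uv; rewrite (inj_eq (@cube_pt_inj d)) (negPf uv) mul0r.
rewrite -(deltaE _ c1) -(deltaE _ c2) -sumrB mulr_sumr; apply: eq_bigr => u _.
by rewrite /haar_highpass -mulrA mulrBl.
Qed.

Lemma haar_filter_bank s (g1 g2 : 'I_s -> 'rV[int]_d) :
  enumerates_pairs g1 g2 ->
  tight_framelet_filter_bank (haar_lowpass R d)
    (fun l => haar_highpass R (g1 l) (g2 l)).
Proof.
move=> g12; have [gc _] := g12; split.
- exact/finitely_supported_cube/haar_lowpass_cube.
- move=> l; have [c1 c2 _] := gc l; apply: finitely_supported_cube => k.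
  exact: haar_highpass_cube.
move=> xi w wc; rewrite !fourier_haar_lowpass.
under [X in _ + X]eq_bigr => l _.
  have [c1 c2 _] := gc l; rewrite !(fourier_haar_highpass _ c1 c2) rmorphM rmorphB.
  rewrite mulrACA; over.
rewrite -mulr_sumr rmorphM mulrACA -mulrDr rmorph_sum.
rewrite (sum_enum_pairs_sub g12 (fun k => expi (- dot (toRd R k) xi))
  (fun k => Num.conj (expi (- dot (toRd R k) (xi + pi *: toRd R w))))).
rewrite cube_character_orthogonality// fmorphV rmorphXn rmorph_nat.
have : (2 ^+ d : R[i]) != 0 by rewrite expf_neq0// pnatr_eq0.
by move: (2 ^+ d) (delta _ _ _) => N D N0; field.
Qed.

Lemma direction_ofN k : @direction_of R _ (- k) = @direction_of R _ k.
Proof.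
have sub j : @direction_of R _ (- j) `<=` @direction_of R _ j.
  move=> _ [t _ <-]; exists (- t) => //.
  by apply/rowP => i; rewrite !mxE mulrNz mulrN mulNr.
by apply/seteqP; split => //; rewrite -{1}[k]opprK; exact: sub.
Qed.

(** Evaluating any other representation of the filter at [g1] and [g2] forces its two points to be
    [g1] and [g2] in some order; exchanging them negates the difference, which spans the same
    line. *)
Lemma filter_direction_haarP (g1 g2 : 'rV[int]_d) D : g1 <> g2 ->
  filter_direction (haar_highpass R g1 g2) D <-> D = @direction_of R _ (g1 - g2).
Proof.
move=> /eqP g12; have N0 : (2 ^+ d : R[i])^-1 != 0.
  by rewrite invr_eq0 expf_neq0// pnatr_eq0.
split=> [[c [h1 [h2 [c0 /eqP h12]]]]|->].
  rewrite /haar_highpass => h.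
  have := congr1 (@^~ g1) h; have := congr1 (@^~ g2) h.
  rewrite /= /delta !eqxx (negPf g12) eq_sym (negPf g12).
  have [e2|g2h1] := eqVneq g2 h1; have [e1|g1h1] := eqVneq g1 h1.
  - by rewrite e1 e2 eqxx in g12.
  - have [<-|g1h2] := eqVneq g1 h2.
      by move=> _ _ ->; rewrite -e2 -direction_ofN opprB.
    by rewrite subr0 mulr1 subrr mulr0 => _ /eqP; rewrite (negPf N0).
  - have [<-|g2h2] := eqVneq g2 h2; first by move=> _ _ ->; rewrite -e1.
    by rewrite subrr mulr0 sub0r mulrN1 => /eqP; rewrite oppr_eq0 (negPf N0).
  - have [<-|g1h2] := eqVneq g1 h2.
      rewrite [g2 == g1]eq_sym (negPf g12) subrr mulr0 sub0r mulrN1.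
      by move=> /eqP; rewrite oppr_eq0 (negPf N0).
    by rewrite subr0 mulr1 subrr mulr0 => _ /eqP; rewrite (negPf N0).
exists ((2 ^+ d)^-1), g1, g2; split => //; exact/eqP.
Qed.

Lemma haar_has_directionality (g1 g2 : 'rV[int]_d) : g1 <> g2 ->
  has_directionality (haar_highpass R g1 g2).
Proof.
move=> /eqP g12; exists g1, g2; split.
- rewrite /haar_highpass /delta eqxx (negPf g12) subr0 mulr1.
  by rewrite invr_gt0 exprn_gt0// ltr0n.
- rewrite /haar_highpass /delta eqxx eq_sym (negPf g12) sub0r mulrN1 oppr_lt0.
  by rewrite invr_gt0 exprn_gt0// ltr0n.
- move=> k /eqP k1 /eqP k2.
  by rewrite /haar_highpass /delta (negPf k1) (negPf k2) subrr mulr0.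
Qed.
End filter_bank.

(** * Counting the directions *)

Section directions.
Variables (R : realType) (d : nat).
Local Notation trits := {ffun 'I_d -> 'I_3}.
Implicit Types (t : trits) (k : 'rV[int]_d).

(* The digits 0, 1, 2 encode the coordinates -1, 0, 1. *)
Definition trits_pt t : 'rV[int]_d := \row_i ((t i : nat)%:Z - 1).

Definition trits_opp t : trits := [ffun i => rev_ord (t i)].

(* One representative of each pair {t, - t} of nonzero vectors of {-1, 0, 1}^d. *)
Definition trits_pos : {set trits} :=
  [set t | (enum_rank t < enum_rank (trits_opp t))%N].

Lemma trits_ptN t : trits_pt (trits_opp t) = - trits_pt t.
Proof.
by apply/rowP => i; rewrite !mxE ffunE; case: (t i) => [] [|[|[|]]].
Qed.

Lemma trits_pt_inj : injective trits_pt.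
Proof.
move=> t t' /rowP tt; apply/ffunP => i; apply/val_inj.
by have := tt i; rewrite !mxE => /addIr[].
Qed.

Lemma trits_oppK : involutive trits_opp.
Proof. by move=> t; apply/ffunP => i; rewrite !ffunE rev_ordK. Qed.

Lemma trits_opp_eq t : (trits_opp t == t) = (trits_pt t == 0).
Proof.
rewrite -(inj_eq trits_pt_inj) trits_ptN; apply/eqP/eqP => [/rowP tt|->].
  by apply/rowP => i; have := tt i; rewrite !mxE; case: (t i) => [] [|[|[|]]].
by rewrite oppr0.
Qed.

(** Only the zero vector is its own opposite. For any other vector the ranks of [t] and of its
    opposite differ, so exactly one of the two is selected. *)
Lemma trits_posP t : trits_pt t != 0 ->
  (trits_opp t \in trits_pos) = (t \notin trits_pos).
Proof.
move=> t0; rewrite !inE trits_oppK -leqNgt [RHS]leq_eqVlt.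
by rewrite (inj_eq (@ord_inj _)) (inj_eq enum_rank_inj) trits_opp_eq (negPf t0).
Qed.

Lemma trits_pos_neq0 t : t \in trits_pos -> trits_pt t != 0.
Proof.
by rewrite inE -trits_opp_eq; apply: contraTneq => ->; rewrite ltnn.
Qed.

(** Once the zero vector [t0], all of whose digits are 1, is removed, the rest is the disjoint union
    of [trits_pos] and its image under negation. *)
Lemma card_trits_pos : #|trits_pos| = ((3 ^ d - 1) %/ 2)%N.
Proof.
pose t0 : trits := [ffun=> inord 1].
have t0E : trits_pt t0 = 0 by apply/rowP => i; rewrite !mxE ffunE inordK.
have -> : (3 ^ d = #|{: trits}|)%N by rewrite card_ffun !card_ord.
rewrite -cardsT (cardsD1 t0) inE add1n subn1/=.
rewrite (_ : _ :\ t0 = trits_pos :|: trits_opp @: trits_pos).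
  rewrite cardsU (_ : _ :&: _ = finset.set0) ?cards0 ?subn0.
    rewrite card_imset; last exact: inv_inj trits_oppK.
    by rewrite addnn -muln2 mulnK.
  apply/setP => t; rewrite !inE; apply/negP => /andP[+ /imsetP[t' t'P tE]].
  rewrite tE => tP; have t'0 := trits_pos_neq0 t'P.
  by have := trits_posP t'0; rewrite t'P inE tP.
apply/setP => t; rewrite !inE andbT.
have -> : (t \in trits_opp @: trits_pos) = (trits_opp t \in trits_pos).
  by rewrite -{1}[t]trits_oppK mem_imset//; exact: inv_inj trits_oppK.
rewrite -(inj_eq trits_pt_inj) t0E; have [tz|tz] := eqVneq (trits_pt t) 0.
  apply/esym/negbTE; rewrite negb_or; apply/andP; split.
    have /eqP : trits_opp t == t by rewrite trits_opp_eq tz.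
    by move=> ->; rewrite ltnn.
  by apply: contraTN isT => /trits_pos_neq0; rewrite trits_ptN tz oppr0 eqxx.
by rewrite trits_posP// inE orbN.
Qed.

(** Vectors spanning the same line are proportional. With entries in {-1,0,1}, a nonzero coordinate
    forces the factor to be 1 or -1, and -1 would put two opposite vectors among the
    representatives. *)
Lemma direction_of_trits_inj :
  {in [set` trits_pos] &, injective (fun t => @direction_of R _ (trits_pt t))}.
Proof.
move=> t t'; rewrite !inE => /= tP t'P dtt'.
have [c cE] : exists c : R, forall i,
    (trits_pt t 0 i)%:~R = c * (trits_pt t' 0 i)%:~R :> R.
  have : @direction_of R _ (trits_pt t) (toRd R (trits_pt t)).
    by exists 1 => //; rewrite scale1r.
  by rewrite dtt' => -[c _ /rowP cE]; exists c => i; have := cE i; rewrite !mxE.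
have tritE (s : trits) i : trits_pt s 0 i \in [:: -1; 0; 1].
  by rewrite mxE; case: (s i) => [] [|[|[|]]].
have [i ti] : exists i, trits_pt t 0 i != 0.
  apply/existsP; apply: contraNT (trits_pos_neq0 tP) => /existsPn tz.
  by apply/eqP/rowP => i; have /negPn/eqP-> := tz i; rewrite mxE.
have : c = 1 \/ c = -1.
  have := cE i; have := tritE t i; have := tritE t' i; rewrite !inE.
  by move=> /or3P[]/eqP-> /or3P[]/eqP e; rewrite e ?eqxx// in ti *; lra.
case=> c1.
  apply/trits_pt_inj/rowP => j; apply: (@intr_inj R).
  by rewrite cE c1 mul1r.
have tE : t = trits_opp t'.
  apply/trits_pt_inj/rowP => j; apply: (@intr_inj R).
  by rewrite cE c1 mulN1r -mulrNz trits_ptN !mxE.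
by have := trits_posP (trits_pos_neq0 t'P); rewrite -tE tP t'P.
Qed.

Lemma card_haar_directions s (g1 g2 : 'I_s -> 'rV[int]_d) :
  enumerates_pairs g1 g2 ->
  (directions (fun l => haar_highpass R (g1 l) (g2 l)) #= `I_((3 ^ d - 1) %/ 2))%card.
Proof.
move=> [gc gu]; rewrite (_ : directions _ =
    (fun t => @direction_of R _ (trits_pt t)) @` [set` trits_pos]).
  apply: card_eq_trans; first exact/inj_card_eq/direction_of_trits_inj.
  have [n tn] := (finite_setP [set` trits_pos]).1 finite_finset.
  rewrite -card_trits_pos cardE (_ : size _ = n)// -(card_fset_set tn).
  apply/perm_size/uniq_perm; rewrite ?enum_uniq ?finmap.fset_uniq// => t.
  by rewrite mem_enum (in_fset_set finite_finset) mem_setE.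
apply/seteqP; split => [D [l]|_ [t /= tP <-]].
  have [/cube01P[u uE] /cube01P[v vE] uv] := gc l.
  rewrite filter_direction_haarP// uE vE => ->.
  (* The digit of u_i - v_i is u_i + 1 - v_i, and [~~ v i] is 1 - v_i. *)
  pose t : trits := [ffun i => inord (u i + ~~ v i)%N].
  have tE : trits_pt t = cube_pt u - cube_pt v.
    apply/rowP => i; rewrite !mxE ffunE inordK; last by case: (u i) (v i) => [] [].
    by case: (u i) (v i) => [] [].
  have t0 : trits_pt t != 0.
    by rewrite tE subr_eq0; apply: contra_not_neq uv; rewrite uE vE.
  have [tP|tP] := boolP (t \in trits_pos); first by exists t => //=; rewrite tE.
  by exists (trits_opp t); rewrite /= ?trits_posP// trits_ptN direction_ofN tE.
(* Conversely, a vector of {-1,0,1}^d is the indicator of its coordinates 1 (digit 2) minus that of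
   its coordinates -1 (digit 0). *)
pose u := [ffun i => val (t i) == 2%N]; pose v := [ffun i => val (t i) == 0%N].
have tE : trits_pt t = cube_pt u - cube_pt v.
  by apply/rowP => i; rewrite !mxE !ffunE; case: (t i) => [] [|[|[|]]].
have uv : cube_pt u <> cube_pt v.
  by apply/eqP; rewrite -subr_eq0 -tE; exact: trits_pos_neq0.
have [l [[[e1 e2]|[e1 e2]] _]] := gu _ _ (cube01_pt u) (cube01_pt v) uv; exists l.
  by rewrite filter_direction_haarP e1 e2// tE.
apply/filter_direction_haarP; first by rewrite e1 e2; exact/nesym.
by rewrite e1 e2 tE -opprB direction_ofN.
Qed.
End directions.

(** * Dyadic cubes *)

Section dyadic.
Context {R : realType}.
Variable d : nat.
Implicit Types (x : 'rV[R]_d) (k : 'rV[int]_d) (n : nat).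
Notation mu := (@lebesgue_rV R d).

(** Half-open cubes are the fibres of this map: at each level they partition the space by
    construction, and their nesting is arithmetic of floors. *)
Definition dyadic_index n x : 'rV[int]_d :=
  \row_i Num.floor (2 ^+ n * x 0 i).

Definition dyadic n k : set 'rV[R]_d := [set x | dyadic_index n x = k].

Let dyadic_itv n (m : int) : set R :=
  [set` `[2^-n * m%:~R, 2^-n * (m + 1)%:~R[].

Let dyadic_itvP n m (y : R) : dyadic_itv n m y <-> Num.floor (2 ^+ n * y) = m.
Proof.
rewrite /dyadic_itv /= in_itv/= ler_pdivrMl ?exprn_gt0// ltr_pdivlMl ?exprn_gt0//.
by rewrite -floor_eq; split => /eqP.
Qed.

Lemma dyadic_box n k :
  dyadic n k = [set x : 'rV[R]_d | forall i, dyadic_itv n (k 0 i) (x 0 i)].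
Proof.
apply/seteqP; split => x.
  by move=> xk i; apply/dyadic_itvP; rewrite -xk mxE.
by move=> xk; apply/rowP => i; rewrite mxE; exact/dyadic_itvP.
Qed.

Lemma measurable_dyadic n k : measurable (dyadic n k).
Proof.
rewrite dyadic_box.
have -> : [set x : 'rV[R]_d | forall i, dyadic_itv n (k 0 i) (x 0 i)] =
    \bigcap_(i in [set: 'I_d]) (@rV_coord R d i @^-1` dyadic_itv n (k 0 i)).
  by apply/seteqP; split=> x /= H i; [move=> _; exact: H|exact: (H i)].
apply: fin_bigcap_measurable => // i _.
rewrite -[X in measurable X]setTI.
by apply: measurable_rV_coord => //; exact: measurable_itv.
Qed.

Lemma lebesgue_dyadic n k : mu (dyadic n k) = ((2 ^+ n) ^- d)%:E.
Proof.
rewrite dyadic_box.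
rewrite [LHS](@lebesgue_rV_box R d (fun i => dyadic_itv n (k 0 i))) => [|i];
  last exact: measurable_itv.
transitivity (\prod_(i < d) ((2 ^- n : R)%:E))%E.
  apply: eq_bigr => i _; rewrite lebesgue_measure_itv/= lte_fin.
  rewrite ltr_pM2l ?invr_gt0 ?exprn_gt0// ltr_int ltrDl ltr01 -EFinB -mulrBr.
  by rewrite -intrB addrAC subrr add0r mulr1.
rewrite prodEFin.
by rewrite prodr_const card_ord exprVn.
Qed.

(** In each coordinate floor(2y) is 2 floor(y) plus a bit. The bits form a vertex of {0,1}^d, which
    is why vertices label the children of a cube. *)
Lemma dyadic_index_double n x k :
  dyadic_index n x = k <->
  exists u, dyadic_index n.+1 x = k *+ 2 + cube_pt u.
Proof.
have half (y : R) (m : int) : Num.floor y = m <->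
    exists b : bool, Num.floor (2 * y) = m *+ 2 + (b : nat)%:Z.
  have fl := floor_itv y; have fl2 := floor_itv (2 * y).
  split=> [<-|[b bE]]; last first.
    apply/eqP; rewrite floor_eq; move: fl2; rewrite bE.
    by case: b {bE} => /=; rewrite !intrD => /andP[h1 h2]; apply/andP; split; lra.
  rewrite intrD in fl; have /andP[h1 h2] := fl.
  have [h|h] := lerP (2 * (Num.floor y)%:~R + 1) (2 * y);
    [exists true|exists false]; apply/eqP; rewrite floor_eq /= !intrD;
    by apply/andP; split; lra.
split=> [<-|[u /rowP uE]].
  have /choice[u uE] i : exists b : bool, Num.floor (2 ^+ n.+1 * x 0 i) =
      Num.floor (2 ^+ n * x 0 i) *+ 2 + (b : nat)%:Z.
    by rewrite exprS -mulrA; exact/half.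
  by exists (finfun u); apply/rowP => i; rewrite !mxE uE ffunE.
apply/rowP => i; rewrite mxE; apply/half; exists (u i).
by have := uE i; rewrite !mxE exprS mulrA.
Qed.

Lemma dyadic_index_coarse n m x y : (n <= m)%N ->
  dyadic_index m x = dyadic_index m y -> dyadic_index n x = dyadic_index n y.
Proof.
move=> /subnKC <-; elim: (m - n)%N => [|p IH]; first by rewrite addn0.
rewrite addnS => xy; apply: IH.
have [u xu] := (dyadic_index_double (n + p) x _).1 erefl.
by apply/esym/dyadic_index_double; exists u; rewrite -xy.
Qed.

Definition dyadics : set (set 'rV[R]_d) :=
  [set A | A = set0 \/ exists n k, A = dyadic n k].

(** If two dyadic cubes meet, the finer one lies inside the coarser one. *)
Lemma setI_closed_dyadics : setI_closed dyadics.
Proof.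
move=> A B [->|[n [k ->]]]; first by rewrite set0I; left.
move=> [->|[m [l ->]]]; first by rewrite setI0; left.
wlog nm : n m k l / (n <= m)%N => [H|].
  by case: (leqP n m) => [|/ltnW]; [|rewrite setIC]; exact: H.
have [->|/set0P[y [yk yl]]] := eqVneq (dyadic n k `&` dyadic m l) set0.
  by left.
right; exists m, l; apply: setIidr => x xl.
by rewrite /dyadic/= -yk; apply: (dyadic_index_coarse nm); rewrite xl.
Qed.

Lemma measurable_dyadics : measurable = <<s dyadics >>.
Proof.
apply/seteqP; split; last first.
  apply: smallest_sub; first exact: sigma_algebra_measurable.
  by move=> A [->|[n [k ->]]]; [exact: measurable0|exact: measurable_dyadic].
(* A set containing a dyadic cube around each of its points is the union of all dyadic cubes inside
   it, of which there are countably many. *)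
have Gmeas (A : set 'rV[R]_d) :
    (forall x, A x -> exists n, dyadic n (dyadic_index n x) `<=` A) ->
    <<s dyadics >> A.
  move=> An; pose F i := if unpickle i is Some (n, k) then
    (if `[< dyadic n k `<=` A >] then dyadic n k else set0) else set0.
  suff -> : A = \bigcup_i F i.
    apply: sigma_algebra_bigcup => i; rewrite /F.
    case: unpickle => [[n k]|]; last exact: sigma_algebra0.
    case: asboolP => _; last exact: sigma_algebra0.
    by apply: sub_sigma_algebra; right; exists n, k.
  apply/seteqP; split => [x Ax|x [i _]].
    have [n nA] := An _ Ax; exists (pickle (n, dyadic_index n x)) => //.
    by rewrite /F pickleK asboolT.
  by rewrite /F; case: unpickle => [[n k]|//]; case: asboolP => // + xk; exact.
apply: smallest_sub; first exact: smallest_sigma_algebra.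
rewrite -bigcup_seq => B [i _ [C mC <-]].
have : measurable_fun [set: g_sigma_algebraType dyadics]
    (rV_coord i : g_sigma_algebraType dyadics -> R).
  apply: (measurability _ (RGenInftyO.measurableE R)).
  move=> _ [_ [a ->] <-]; rewrite setTI; apply: Gmeas => x /=.
  rewrite in_itv/= /rV_coord => xa.
  have /ltW ax0 : 0 < (a - x 0 i)^-1 by rewrite invr_gt0 subr_gt0.
  (* At this level the side 2^-n is smaller than a - x_i, so the cube of [x] stays inside the open
     half-space of points whose coordinate [i] is below [a]. *)
  pose n := Num.bound (a - x 0 i)^-1; exists n => y /rowP /(_ i) xy.
  rewrite /= in_itv/=.
  have n2 : (a - x 0 i)^-1 < 2 ^+ n.
    rewrite (lt_trans (archi_boundP ax0))// -natrX ltr_nat; exact: ltn_expl.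
  have : 1 < 2 ^+ n * (a - x 0 i).
    by rewrite -ltr_pdivrMr ?subr_gt0// mul1r.
  have := floor_itv (2 ^+ n * x 0 i); have := floor_itv (2 ^+ n * y 0 i).
  rewrite !mxE in xy; rewrite xy !intrD => /andP[_ h1] /andP[h2 _] h3.
  have : 2 ^+ n * y 0 i < 2 ^+ n * a by rewrite mulrBr in h3; lra.
  by rewrite ltr_pM2l// exprn_gt0.
by move=> /(_ measurableT C mC); rewrite !setTI.
Qed.

(** [pickle_inv] answers only on the code of an index, so no cube is listed twice and the family is
    pairwise disjoint; the remaining positions hold the empty set. *)
Definition dyadic_cover n (i : nat) : set 'rV[R]_d :=
  if pickle_inv i is Some k then dyadic n k else set0.

Lemma dyadic_cover_dyadics n i : dyadics (dyadic_cover n i).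
Proof.
rewrite /dyadic_cover; case: pickle_inv => [k|]; last by left.
by right; exists n, k.
Qed.

Lemma bigcup_dyadic_cover n : \bigcup_i dyadic_cover n i = setT.
Proof.
apply/seteqP; split => // x _; exists (pickle (dyadic_index n x)) => //.
by rewrite /dyadic_cover pickleK_inv.
Qed.

Lemma trivIset_dyadic_cover n : trivIset setT (dyadic_cover n).
Proof.
apply/trivIsetP => i j _ _; apply: contraNeq => /set0P[x []].
rewrite /dyadic_cover; have := @pickle_invK 'rV[int]_d i; have := @pickle_invK 'rV[int]_d j.
by case: pickle_inv => [l|//]; case: pickle_inv => [k|//] /= <- <- <- <-.
Qed.

Lemma lebesgue_dyadic_cover n i : (mu (dyadic_cover n i) < +oo)%E.
Proof.
rewrite /dyadic_cover; case: pickle_inv => [k|]; last by rewrite measure0.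
by rewrite lebesgue_dyadic ltry.
Qed.

End dyadic.

(** * Change of variables x |-> 2x - k *)

Section change_of_variables.
Context {R : realType}.
Variable d : nat.
Implicit Types (x : 'rV[R]_d) (k : 'rV[int]_d) (n : nat).
Notation mu := (@lebesgue_rV R d).

Definition refine k x : 'rV[R]_d := 2 *: x - toRd R k.

Lemma measurable_refine k : measurable_fun setT (refine k).
Proof.
apply: measurable_fun_rVP => i.
rewrite (_ : _ \o _ = (fun x => 2 * rV_coord i x - (k 0 i)%:~R)).
  apply: measurable_funB => //; apply: measurable_funM => //.
  exact: measurable_rV_coord.
by apply/funext => x; rewrite /rV_coord /= !mxE.
Qed.

Lemma dyadic_index_dilate m n k x :
  dyadic_index m (2 ^+ n *: x - toRd R k) = dyadic_index (n + m) x - k *+ 2 ^ m.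
Proof.
apply/rowP => i; rewrite !mxE mulrBr mulrA -exprD addnC floorDrz.
  congr (_ + _); rewrite (_ : - _ = (- (k 0 i *+ 2 ^ m))%:~R) ?intrKfloor//.
    by rewrite mulmxnE.
  by rewrite rmorphN rmorphMn -[in RHS]mulr_natl natrX.
by rewrite rpredN rpredM ?rpredX ?intr_int ?rpred_nat//.
Qed.

Lemma refine_dyadic k n l :
  refine k @^-1` dyadic n l = dyadic n.+1 (l + k *+ 2 ^ n).
Proof.
have idx x : dyadic_index n (refine k x) = dyadic_index n.+1 x - k *+ 2 ^ n.
  by rewrite -[n.+1]/(1 + n)%N -dyadic_index_dilate.
apply/seteqP; split => x; rewrite /dyadic/= idx.
  by move=> /eqP; rewrite subr_eq => /eqP.
by move=> ->; rewrite addrK.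
Qed.

(* The instance is named because its measurability proof cannot be inferred. *)
Definition refine_image k : {measure set 'rV[R]_d -> \bar R} :=
  measure_function_pushforward__canonical__measure_function_Measure
    mu (measurable_refine k).

(** Both sides are measures in [A]. They agree on dyadic cubes, whose preimages are cubes one level
    finer, and a measure is determined by its values on this generating pi-system. *)
Lemma lebesgue_refine k A : measurable A ->
  (mu (refine k @^-1` A) = (2 ^- d)%:E * mu A)%E.
Proof.
move=> mA; have c0 : 0 <= (2 ^- d : R) by rewrite invr_ge0 exprn_ge0.
pose m1 : {measure set 'rV[R]_d -> \bar R} := mscale (NngNum c0) mu.
pose m2 := refine_image k.
transitivity (m2 A) => //; transitivity (m1 A) => //; apply/esym.
apply: (measure_unique (@dyadics R d) (@dyadic_cover R d 0)) => //.
- exact: measurable_dyadics.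
- exact: setI_closed_dyadics.
- exact: dyadic_cover_dyadics.
- exact: bigcup_dyadic_cover.
- move=> B [->|[n [l ->]]]; first by rewrite !measure0.
  change ((2 ^- d)%:E * mu (dyadic n l) = mu (refine k @^-1` dyadic n l))%E.
  by rewrite refine_dyadic !lebesgue_dyadic -EFinM exprS exprMn invfM.
- move=> i; rewrite /m1 /mscale /=; apply: lte_mul_pinfty => //.
  exact: lebesgue_dyadic_cover.
Qed.

Lemma ge0_integral_refine k (f : 'rV[R]_d -> \bar R) :
  measurable_fun setT f -> (forall x, 0 <= f x)%E ->
  (\int[mu]_x f (refine k x) = (2 ^- d)%:E * \int[mu]_x f x)%E.
Proof.
move=> mf f0; have c0 : 0 <= (2 ^- d : R) by rewrite invr_ge0 exprn_ge0.
rewrite -(ge0_integral_mscale mu measurableT (NngNum c0))//.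
rewrite -(preimage_setT (refine k)).
rewrite -(ge0_integral_pushforward (measurable_refine k) mu)//.
apply: (@eq_measure_integral _ _ _ _ (mscale (NngNum c0) mu)
  (refine_image k)).
by move=> A mA _; exact: lebesgue_refine.
Qed.

Lemma Rintegral_refine k (f : 'rV[R]_d -> R) :
  mu.-integrable setT (EFin \o f) ->
  \int[mu]_x f (refine k x) = 2 ^- d * \int[mu]_x f x.
Proof.
move=> fi; have /measurable_int mf := fi.
have [fp fn] := (integrable_pos_fin_num measurableT fi, integrable_neg_fin_num measurableT fi).
rewrite /Rintegral integralE [in RHS]integralE.
change (fine (\int[mu]_x ((EFin \o f) \o refine k)^\+ x -
  \int[mu]_x ((EFin \o f) \o refine k)^\- x)%E =
  2 ^- d * fine (\int[mu]_x (EFin \o f)^\+ x - \int[mu]_x (EFin \o f)^\- x)%E).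
rewrite funepos_comp funeneg_comp.
rewrite (ge0_integral_refine k (measurable_funepos mf))//.
rewrite (ge0_integral_refine k (measurable_funeneg mf))//.
by rewrite -(fineK fp) -(fineK fn) -!EFinM -!EFinB /= mulrBr.
Qed.

Lemma integrable_refine k (f : 'rV[R]_d -> R) :
  mu.-integrable setT (EFin \o f) ->
  mu.-integrable setT (EFin \o (fun x => f (refine k x))).
Proof.
move=> /integrableP[mf fi]; apply/integrableP; split.
  exact: (measurableT_comp mf (measurable_refine k)).
rewrite (ge0_integral_refine k (f := fun x => `|(f x)%:E|%E))//.
  by apply: lte_mul_pinfty.
exact: measurableT_comp.
Qed.

Definition cintegrable (f : 'rV[R]_d -> R[i]) :=
  mu.-integrable setT (EFin \o (fun x => complex.Re (f x))) /\
  mu.-integrable setT (EFin \o (fun x => complex.Im (f x))).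

Lemma complex_ReM (a b : R[i]) :
  complex.Re (a * b) = complex.Re a * complex.Re b - complex.Im a * complex.Im b.
Proof. by case: a; case: b. Qed.

Lemma complex_ImM (a b : R[i]) :
  complex.Im (a * b) = complex.Re a * complex.Im b + complex.Im a * complex.Re b.
Proof. by case: a; case: b. Qed.

Lemma cintegral_refine k f : cintegrable f ->
  cintegral (fun x => f (refine k x)) = 2 ^- d * cintegral f.
Proof.
move=> [fr fim]; rewrite /cintegral (Rintegral_refine k fr) (Rintegral_refine k fim).
have -> : (2 ^- d : R[i]) = (2 ^- d)%:C.
  by rewrite fmorphV rmorphXn rmorph_nat.
by apply/eqP; rewrite eq_complex /= !mul0r subr0 addr0 !eqxx.
Qed.

Lemma cintegrable_refine k f : cintegrable f ->
  cintegrable (fun x => f (refine k x)).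
Proof.
by move=> [fr fim]; split; [exact: (integrable_refine k fr)|exact: (integrable_refine k fim)].
Qed.

Lemma integrable_EFinZl (c : R) (f : 'rV[R]_d -> R) :
  mu.-integrable setT (EFin \o f) ->
  mu.-integrable setT (EFin \o (fun x => c * f x)).
Proof.
move=> fi; apply: (eq_integrable measurableT (fun x => (c%:E * (f x)%:E)%E)).
  by move=> x _; rewrite /= EFinM.
exact: integrableZl.
Qed.

Lemma cintegrableZ (c : R[i]) f : cintegrable f ->
  cintegrable (fun x => c * f x).
Proof.
move=> [fr fim]; split.
  apply: (eq_integrable measurableT
    (fun x => ((complex.Re c)%:E * (complex.Re (f x))%:E -
      (complex.Im c)%:E * (complex.Im (f x))%:E)%E)).
    by move=> x _; rewrite /= complex_ReM EFinB !EFinM.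
  by apply: integrableB => //; exact: integrableZl.
apply: (eq_integrable measurableT
  (fun x => ((complex.Re c)%:E * (complex.Im (f x))%:E +
      (complex.Im c)%:E * (complex.Re (f x))%:E)%E)).
  by move=> x _; rewrite /= complex_ImM EFinD !EFinM.
by apply: integrableD => //; exact: integrableZl.
Qed.

Lemma cintegralZ (c : R[i]) f : cintegrable f ->
  cintegral (fun x => c * f x) = c * cintegral f.
Proof.
move=> [fr fim]; rewrite /cintegral; apply/eqP; rewrite eq_complex complex_ReM complex_ImM /=.
apply/andP; split; apply/eqP.
  rewrite -!RintegralZl// -RintegralB//; [|exact: integrable_EFinZl|exact: integrable_EFinZl].
  by apply: eq_Rintegral => x _; rewrite complex_ReM.
rewrite -!RintegralZl// -RintegralD//; [|exact: integrable_EFinZl|exact: integrable_EFinZl].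
by apply: eq_Rintegral => x _; rewrite complex_ImM.
Qed.

Lemma complex_ReD (a b : R[i]) : complex.Re (a + b) = complex.Re a + complex.Re b.
Proof. by case: a; case: b. Qed.

Lemma complex_ImD (a b : R[i]) : complex.Im (a + b) = complex.Im a + complex.Im b.
Proof. by case: a; case: b. Qed.

Lemma cintegrableD f g : cintegrable f -> cintegrable g ->
  cintegrable (fun x => f x + g x).
Proof.
move=> [fr fim] [gr gim]; split.
  apply: (eq_integrable measurableT
    (((EFin \o (fun x => complex.Re (f x))) \+
      (EFin \o (fun x => complex.Re (g x))))%E)).
    by move=> x _; rewrite /= complex_ReD.
  exact: integrableD.
apply: (eq_integrable measurableT
  (((EFin \o (fun x => complex.Im (f x))) \+
      (EFin \o (fun x => complex.Im (g x))))%E)).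
  by move=> x _; rewrite /= complex_ImD.
exact: integrableD.
Qed.

Lemma cintegralD f g : cintegrable f -> cintegrable g ->
  cintegral (fun x => f x + g x) = cintegral f + cintegral g.
Proof.
move=> [fr fim] [gr gim]; rewrite /cintegral.
apply/eqP; rewrite eq_complex /= -!RintegralD//; apply/andP; split; apply/eqP.
  by apply: eq_Rintegral => x _; rewrite complex_ReD.
by apply: eq_Rintegral => x _; rewrite complex_ImD.
Qed.

Lemma cintegral_sum (I : Type) (r : seq I) (f : I -> 'rV[R]_d -> R[i]) :
  (forall i, cintegrable (f i)) ->
  cintegral (fun x => \sum_(i <- r) f i x) = \sum_(i <- r) cintegral (f i).
Proof.
move=> fi; have sumi s : cintegrable (fun x => \sum_(i <- s) f i x).
  elim: s => [|i s IH].
    under eq_fun do rewrite big_nil.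
    by split; exact: integrable0.
  by under eq_fun do rewrite big_cons; exact: cintegrableD.
elim: r => [|i r IH]; last first.
  by under eq_fun do rewrite big_cons; rewrite big_cons cintegralD// IH.
under eq_fun do rewrite big_nil.
by rewrite big_nil /cintegral /= /Rintegral integral0.
Qed.

End change_of_variables.

(** * The Haar functions and their Fourier transforms *)

Section haar_functions.
Context {R : realType}.
Variable d : nat.
Implicit Types (x xi : 'rV[R]_d) (k : 'rV[int]_d) (n : nat).
Notation mu := (@lebesgue_rV R d).

Definition haar_scaling x : R[i] := (\1_(dyadic 0 0) x)%:C.

Definition haar_wavelet k l x : R[i] :=
  haar_scaling (refine k x) - haar_scaling (refine l x).

Lemma in_dyadic n k x : (x \in dyadic n k) = (dyadic_index n x == k).
Proof. by apply/idP/eqP; rewrite inE. Qed.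

Lemma haar_scaling_refine k x :
  haar_scaling (refine k x) = (\1_(dyadic 1 k) x)%:C.
Proof.
have := @refine_dyadic R d k 0 0; rewrite add0r expn0 mulr1n => /seteqP[h1 h2].
rewrite /haar_scaling !indicE; congr ((_ : bool)%:R)%:C.
by apply/idP/idP; rewrite !inE; [exact: h1|exact: h2].
Qed.

Lemma indic_dyadic_split n k x : \1_(dyadic n k) x =
  \sum_u \1_(dyadic n.+1 (k *+ 2 + cube_pt u)) x :> R.
Proof.
rewrite indicE in_dyadic; case: eqP => [/dyadic_index_double[u xu]|xk].
  rewrite (bigD1 u)//= big1 ?addr0 => [|v vu]; rewrite indicE in_dyadic xu ?eqxx//.
  by rewrite (inj_eq (addrI _)) (inj_eq (@cube_pt_inj d)) eq_sym (negPf vu).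
rewrite big1// => u _; rewrite indicE in_dyadic; case: eqP => // xu.
by exfalso; apply: xk; apply/dyadic_index_double; exists u.
Qed.

Lemma haar_scaling_split x :
  haar_scaling x = \sum_u haar_scaling (refine (cube_pt u) x).
Proof.
under eq_bigr do rewrite haar_scaling_refine.
rewrite -rmorph_sum /haar_scaling indic_dyadic_split; congr (_%:C).
by apply: eq_bigr => u _; rewrite mul0rn add0r.
Qed.

Lemma measurable_dot xi : measurable_fun setT (fun x => dot x xi).
Proof.
rewrite /dot; apply: measurable_sum => i.
by apply: measurable_funM => //; exact: measurable_rV_coord.
Qed.

Lemma measurable_comp_dot (g : R -> R) xi : measurable_fun setT g ->
  measurable_fun setT (fun x => g (- dot x xi)).
Proof.
by move=> mg; exact: (measurableT_comp mg (measurable_funN (measurable_dot xi))).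
Qed.

Lemma integrable_indic_lty (A : set 'rV[R]_d) : measurable A ->
  (mu A < +oo)%E -> mu.-integrable setT (EFin \o \1_A).
Proof.
move=> mA Aoo; apply/integrableP; split.
  by apply/measurable_EFinP; exact: measurable_indic.
rewrite (eq_integral (fun x => (\1_A x)%:E)); last first.
  by move=> t _; rewrite /= ger0_norm.
by rewrite integral_indic// setIT.
Qed.

Lemma integrable_indic_dyadic n k : mu.-integrable setT (EFin \o \1_(dyadic n k)).
Proof.
apply: integrable_indic_lty; first exact: measurable_dyadic.
by rewrite lebesgue_dyadic ltry.
Qed.

Lemma integral_indic_dyadic n k :
  (\int[mu]_x (\1_(dyadic n k) x)%:E)%E = ((2 ^+ n) ^- d)%:E.
Proof.
rewrite integral_indic//; last exact: measurable_dyadic.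
by rewrite setIT; exact: lebesgue_dyadic.
Qed.

Lemma integrable_indic_mul n k (h : 'rV[R]_d -> R) : measurable_fun setT h ->
  (forall x, `|h x| <= 1) ->
  mu.-integrable setT (EFin \o (fun x => \1_(dyadic n k) x * h x)).
Proof.
move=> mh h1.
apply: (eq_integrable measurableT
  ((EFin \o \1_(dyadic n k)) \* (EFin \o h))%E).
  by move=> x _; rewrite /= EFinM.
apply: integrableMl => //.
  exact: integrable_indic_dyadic.
exists 1; split; rewrite ?num_real// => M M1 x _.
by apply: (le_trans (h1 x)); exact: ltW.
Qed.

Lemma norm_cos_le1 (t : R) : `|cos t| <= 1.
Proof. by rewrite ler_norml cos_geN1 cos_le1. Qed.

Lemma norm_sin_le1 (t : R) : `|sin t| <= 1.
Proof. by rewrite ler_norml sin_geN1 sin_le1. Qed.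

Lemma Re_haar_expi x (t : R) :
  complex.Re (haar_scaling x * expi t) = \1_(dyadic 0 0) x * cos t.
Proof. by rewrite complex_ReM /= mul0r subr0. Qed.

Lemma Im_haar_expi x (t : R) :
  complex.Im (haar_scaling x * expi t) = \1_(dyadic 0 0) x * sin t.
Proof. by rewrite complex_ImM /= mul0r addr0. Qed.

Lemma cintegrable_haar_expi xi :
  cintegrable (fun x => haar_scaling x * expi (- dot x xi)).
Proof.
split.
  under eq_fun do rewrite Re_haar_expi.
  apply: (@integrable_indic_mul _ _ (fun x => cos (- dot x xi))) => [|x]; last exact: norm_cos_le1.
  apply: measurable_comp_dot; apply: continuous_measurable_fun; exact: continuous_cos.
under eq_fun do rewrite Im_haar_expi.
apply: (@integrable_indic_mul _ _ (fun x => sin (- dot x xi))) => [|x]; last exact: norm_sin_le1.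
apply: measurable_comp_dot; apply: continuous_measurable_fun; exact: continuous_sin.
Qed.

(** The point [x] is half the sum of [refine k x] and [k], so the character splits into a constant
    phase and a character of [refine k x] at half the frequency. *)
Lemma refine_character k x xi (f : 'rV[R]_d -> R[i]) :
  f (refine k x) * expi (- dot x xi) =
  expi (- dot (toRd R k) (2^-1 *: xi)) *
    (f (refine k x) * expi (- dot (refine k x) (2^-1 *: xi))).
Proof.
rewrite mulrCA -expiD; congr (_ * expi _).
rewrite /refine -(scaleN1r (toRd R k)) dotDl !dotZl !dotZr; lra.
Qed.

Lemma fourier_haar_refine k xi :
  cintegrable (fun x => haar_scaling (refine k x) * expi (- dot x xi)) /\
  fourier (fun x => haar_scaling (refine k x)) xi =
  2 ^- d * expi (- dot (toRd R k) (2^-1 *: xi)) *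
    fourier haar_scaling (2^-1 *: xi).
Proof.
rewrite /fourier; under eq_fun do rewrite refine_character.
have fi := cintegrable_refine k (cintegrable_haar_expi (2^-1 *: xi)).
split; first exact: cintegrableZ.
rewrite cintegralZ//.
rewrite (cintegral_refine k (cintegrable_haar_expi (2^-1 *: xi))).
by rewrite mulrCA mulrA.
Qed.

(** The unit cube is the union of its 2^d children; the factor 2^-d from the change of variables is
    the coefficient of the Haar filter and the phases are its characters. *)
Lemma fourier_haar_scaling_refinement xi : fourier haar_scaling xi =
  fourier_series (haar_lowpass R d) (2^-1 *: xi) *
    fourier haar_scaling (2^-1 *: xi).
Proof.
rewrite fourier_haar_lowpass {1}/fourier.
under eq_fun do rewrite haar_scaling_split mulr_suml.
rewrite cintegral_sum => [|u]; last by have [] := fourier_haar_refine (cube_pt u) xi.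
rewrite mulr_sumr mulr_suml; apply: eq_bigr => u _.
by have [_] := fourier_haar_refine (cube_pt u) xi.
Qed.

Lemma fourier_haar_wavelet k l xi : cube01 k -> cube01 l ->
  fourier (haar_wavelet k l) xi =
  fourier_series (haar_highpass R k l) (2^-1 *: xi) *
    fourier haar_scaling (2^-1 *: xi).
Proof.
move=> kc lc; rewrite fourier_haar_highpass//.
have [ik ek] := fourier_haar_refine k xi; have [il el] := fourier_haar_refine l xi.
rewrite mulrBr mulrBl -ek -el.
rewrite /fourier -[X in _ - X]mul1r -mulNr -cintegralZ// -cintegralD//; last exact: cintegrableZ.
by congr cintegral; apply/funext => x; rewrite mulN1r -mulrBl.
Qed.

Lemma fourier_haar_scaling_prod n xi : fourier haar_scaling xi =
  (\prod_(1 <= j < n.+1) fourier_series (haar_lowpass R d) ((2 ^+ j)^-1 *: xi)) *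
    fourier haar_scaling ((2 ^+ n)^-1 *: xi).
Proof.
elim: n => [|n IH]; first by rewrite big_geq// mul1r expr0 invr1 scale1r.
rewrite IH [in RHS]big_nat_recr//= -mulrA; congr (_ * _).
by rewrite [LHS]fourier_haar_scaling_refinement scalerA -invfM -exprS.
Qed.

Lemma norm_fourier_haar_lowpass xi :
  `|fourier_series (haar_lowpass R d) xi| <= 1.
Proof.
rewrite fourier_haar_lowpass normrM.
have N0 : 0 < (2 ^+ d : R[i]) by rewrite exprn_gt0// ltr0n.
rewrite ger0_norm ?invr_ge0 ?(ltW N0)// ler_pdivrMl// mulr1.
apply: (le_trans (ler_norm_sum _ _ _)).
under eq_bigr do rewrite norm_expi.
by rewrite sumr_const card_cube natrX.
Qed.

(** Meant for cosine and sine. The convergence is dominated by the indicator of the unit cube, whose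
    measure 1 leaves [g 0] as the limit. *)
Lemma cvg_integral_small_frequency (g : R -> R) xi :
  continuous g -> (forall t, `|g t| <= 1) ->
  (fun n => \int[mu]_x (\1_(dyadic 0 0) x * g (- dot x ((2 ^+ n)^-1 *: xi))))
    @ \oo --> g 0.
Proof.
move=> cg g1; have mg := continuous_measurable_fun cg.
pose f_ n x := (\1_(dyadic 0 0) x * g (- dot x ((2 ^+ n)^-1 *: xi)))%:E.
pose f x := (\1_(dyadic 0 0) x * g 0)%:E.
have g0E : (g 0)%:E = (\int[mu]_x f x)%E.
  under eq_integral do rewrite /f mulrC EFinM.
  rewrite integralZl//; last first.
    exact: integrable_indic_dyadic.
  by rewrite integral_indic_dyadic expr0 expr1n invr1 mule1.
have [|||||_ _] := @dominated_convergence _ _ _ mu setT measurableT f_ f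
  (EFin \o \1_(dyadic 0 0)).
- move=> n; apply/measurable_EFinP/measurable_funM.
    by apply: measurable_indic; exact: measurable_dyadic.
  exact: measurable_comp_dot.
- by apply/measurable_EFinP/measurable_funM => //;
  apply: measurable_indic; exact: measurable_dyadic.
- apply: aeW => x _; apply: cvg_EFin; first exact: nearW.
  apply: cvgM; first exact: cvg_cst.
  apply: continuous_cvg; first exact: cg.
  under eq_fun do rewrite dotZr.
  rewrite -oppr0; apply: cvgN; rewrite -(mul0r (dot x xi)).
  apply: cvgM; last exact: cvg_cst.
  under eq_fun do rewrite -exprVn.
  by apply: cvg_expr; rewrite ger0_norm ?invr_ge0// invf_lt1// ltr1n.
- exact: integrable_indic_dyadic.
- apply: aeW => x n _; rewrite /= lee_fin normrM ger0_norm//.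
  by rewrite ler_piMr.
- by rewrite -g0E => /fine_cvg.
Qed.

Lemma fourier_haar_scalingE xi : fourier haar_scaling xi =
  (\int[mu]_x (\1_(dyadic 0 0) x * cos (- dot x xi))) +i*
  (\int[mu]_x (\1_(dyadic 0 0) x * sin (- dot x xi))).
Proof.
by congr Complex; apply: eq_Rintegral => x _;
  rewrite (Re_haar_expi, Im_haar_expi).
Qed.

Lemma cvg_fourier_haar_scaling0 xi :
  (fun n => ComplexField.Normc.normc
    (fourier haar_scaling ((2 ^+ n)^-1 *: xi) - 1)) @ \oo --> (0 : R).
Proof.
under eq_fun do rewrite fourier_haar_scalingE /= subr0.
have cre : (fun n => \int[mu]_x (\1_(dyadic 0 0) x *
    cos (- dot x ((2 ^+ n)^-1 *: xi))) - 1) @ \oo --> (1 : R) - 1.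
  apply: cvgB; last exact: cvg_cst.
  have := cvg_integral_small_frequency xi (@continuous_cos R) norm_cos_le1.
  by rewrite cos0.
have cim : (fun n => \int[mu]_x (\1_(dyadic 0 0) x *
    sin (- dot x ((2 ^+ n)^-1 *: xi)))) @ \oo --> (0 : R).
  have := cvg_integral_small_frequency xi (@continuous_sin R) norm_sin_le1.
  by rewrite sin0.
have -> : (0 : R) = Num.sqrt ((1 - 1) ^+ 2 + 0 ^+ 2).
  by rewrite subrr expr0n addr0 sqrtr0.
apply: continuous_cvg; first exact: sqrt_continuous.
exact: (cvgD (cvgM cre cre) (cvgM cim cim)).
Qed.

Lemma haar_infinite_product xi :
  (fun n => \prod_(1 <= j < n.+1)
     fourier_series (haar_lowpass R d) ((2 ^+ j)^-1 *: xi) : R[i]^o) @ \oo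
  --> (fourier haar_scaling xi : R[i]^o).
Proof.
apply/cvgrPdist_lt => e e0.
(* A positive element of [R[i]] is real, so the radius comes from a real number. *)
have [r r0 er] : exists2 r : R, 0 < r & e = r%:C.
  by exists (complex.Re e); move: e0; rewrite ltcE /= => /andP[/eqP + //];
    case: e => a b /= ->.
have /cvgrPdist_lt/(_ _ r0) := cvg_fourier_haar_scaling0 xi.
apply: filterS => n; rewrite sub0r normrN ger0_norm; last exact: sqrtr_ge0.
(* The limit contains the partial product as a factor, so the error is that product, of modulus at
   most 1, times the distance of the remaining factor from 1. *)
move=> nr; rewrite (fourier_haar_scaling_prod n) -[X in _ - X]mulr1 -mulrBr normrM.
rewrite er (le_lt_trans _ (_ : `|fourier haar_scaling ((2 ^+ n)^-1 *: xi) - 1| < _))//.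
  rewrite ler_piMl// normr_prod; apply: prodr_ile1 => j _.
  by rewrite normr_ge0 norm_fourier_haar_lowpass.
by rewrite ltcR.
Qed.

Lemma compactly_supported_unit_box (f : 'rV[R]_d -> R[i]) :
  (forall x, ~ dyadic 0 0 x -> f x = 0) -> compactly_supported f.
Proof.
move=> f0; pose K := [set v : 'rV[R]_d | forall i, `[0, 1]%classic (v ord0 i)].
have cK : compact K.
  by apply: (@rV_compact R d (fun=> `[0, 1]%classic)) => _; exact: segment_compact.
apply: (subclosed_compact _ cK); first exact: closed_closure.
have -> : K = closure K.
  by apply/closure_id; exact: (compact_closed (@norm_hausdorff R 'rV[R]_d) cK).
apply: closure_subset => x /= fx i.
have /rowP/(_ i) : dyadic 0 0 x by apply: contrapT => /f0 fx0; rewrite fx0 eqxx in fx.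
rewrite !mxE expr0 mul1r => /eqP; rewrite floor_eq add0r => /andP[x0 /ltW x1].
by rewrite /= in_itv /= x0.
Qed.

Lemma compactly_supported_haar_scaling : compactly_supported haar_scaling.
Proof.
apply: compactly_supported_unit_box => x xn.
by rewrite /haar_scaling indicE memNset.
Qed.

Lemma compactly_supported_haar_wavelet k l : cube01 k -> cube01 l ->
  compactly_supported (haar_wavelet k l).
Proof.
move=> kc lc; apply: compactly_supported_unit_box => x xn.
(* For a vertex [j] the cube of level 1 and index [j] is a child of the unit cube. *)
have out j : cube01 j -> haar_scaling (refine j x) = 0.
  move=> /cube01P[u ->]; rewrite haar_scaling_refine indicE memNset// => xu.
  by apply/xn/dyadic_index_double; exists u; rewrite mul0rn add0r.
by rewrite /haar_wavelet !out// subrr.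
Qed.

End haar_functions.

(** * Dyadic energies *)

(** Division by 2 in each coordinate: the quotients give the parent, the remainders the vertex. *)
Lemma bij_dyadic_child d : set_bij [set: 'rV[int]_d * {ffun 'I_d -> bool}] setT
  (fun p => p.1 *+ 2 + cube_pt p.2 : 'rV[int]_d).
Proof.
split=> // [[k u] [l v] _ _ /= /rowP kl|k _].
  have e i : k 0 i = l 0 i /\ u i = v i.
    have := kl i; rewrite !mxE.
    by case: (u i) (v i) => [] [] /= h; split=> //; lia.
  by congr pair; [apply/rowP => i|apply/ffunP => i]; have [] := e i.
exists (\row_i divz (k 0 i) 2, [ffun i => modz (k 0 i) 2 != 0]) => //=.
apply/rowP => i; rewrite !mxE ffunE [RHS](divz_eq _ 2).
have h1 := modz_ge0 (k 0 i) (isT : 2%:Z != 0).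
have h2 := ltz_pmod (k 0 i) (isT : 0 < 2%:Z).
by move: h1 h2; case: eqP => /= ? ? ?; lia.
Qed.

Section energy.
Context {R : realType}.
Variable d : nat.
Implicit Types (x : 'rV[R]_d) (k : 'rV[int]_d) (n : nat) (u v : 'rV[R]_d -> R).
Notation mu := (@lebesgue_rV R d).
Local Open Scope ereal_scope.

(** Brings sums over lattice points to series over the naturals, where countable additivity and
    scaling are available; positions that encode nothing contribute 0. *)
Lemma esum_pickle (T : countType) (g : T -> \bar R) : (forall t, 0 <= g t) ->
  \esum_(t in [set: T]) g t = \sum_(0 <= i <oo) oapp g 0 (pickle_inv i).
Proof.
move=> g0; rewrite nneseries_esumT; last by move=> i; case: pickle_inv => /=.
rewrite -(setIT setT) [RHS](esumID (range (@pickle T))); last first.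
  by move=> i _; case: pickle_inv => /=.
rewrite [X in _ + X]esum1 ?adde0; last first.
  move=> i [_ /= ni]; have := @pickle_invK T i.
  by case: pickle_inv => //= k ki; exfalso; apply: ni; exists k.
rewrite setIT setTI esum_image; last by move=> k l _ _; exact: (pcan_inj pickleK).
by apply: eq_esum => k _ /=; rewrite pickleK_inv.
Qed.

Lemma esum_fin (T : finType) (g : T -> \bar R) : (forall t, 0 <= g t) ->
  \esum_(t in [set: T]) g t = \sum_t g t.
Proof.
move=> g0; rewrite esum_fset//; last exact: finite_finset.
by rewrite (fsbig_fwiden (index_enum _)) ?index_enum_uniq//= => u;
  rewrite /= ?mem_index_enum//; case.
Qed.

Lemma esum_dyadic_child (a : 'rV[int]_d -> \bar R) : (forall k, 0 <= a k) ->
  \esum_(k in setT) a k =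
  \esum_(k in setT) \sum_u a (k *+ 2 + cube_pt u)%R.
Proof.
move=> a0; rewrite (reindex_esum _ _ _ _ (@bij_dyadic_child d)).
transitivity (\esum_(p in [set: 'rV[int]_d] `*`` (fun=> [set: {ffun 'I_d -> bool}]))
    a (p.1 *+ 2 + cube_pt p.2)%R).
  by congr esum; apply/seteqP; split.
rewrite -(@esum_esum R _ _ setT (fun=> setT) (fun k w => a (k *+ 2 + cube_pt w)%R))//.
by apply: eq_esum => k _; rewrite esum_fin.
Qed.

Lemma integral_dyadic_partition n (f : 'rV[R]_d -> \bar R) :
  measurable_fun setT f -> (forall x, 0 <= f x) ->
  \int[mu]_x f x = \esum_(k in setT) \int[mu]_(x in dyadic n k) f x.
Proof.
move=> mf f0; rewrite esum_pickle; last by move=> k; exact: integral_ge0.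
transitivity (\int[mu]_(x in \bigcup_i @dyadic_cover R d n i) f x).
  by rewrite bigcup_dyadic_cover.
rewrite ge0_integral_bigcup//.
- apply: eq_eseriesr => i _; rewrite /dyadic_cover.
  by case: pickle_inv => //=; rewrite integral_set0.
- move=> i; rewrite /dyadic_cover.
  by case: pickle_inv => [k|]; [exact: measurable_dyadic|exact: measurable0].
- by rewrite bigcup_dyadic_cover.
- exact: trivIset_dyadic_cover.
Qed.

Definition sqnorm u : \bar R := \int[mu]_x ((u x) ^+ 2)%:E.

Definition square_integrable u := measurable_fun setT u /\ sqnorm u < +oo.

Definition dyadic_coef n k u : R := (\int[mu]_x (\1_(dyadic n k) x * u x))%R.

(** This is the squared norm of the conditional expectation of [u] on the cubes of level [n]:
    (2^n)^d is the inverse measure of such a cube. *)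
Definition dyadic_energy n u : \bar R :=
  \esum_(k in setT) ((2 ^+ n) ^+ d * dyadic_coef n k u ^+ 2)%:E.

Lemma sqnorm_ge0 u : 0 <= sqnorm u.
Proof. by apply: integral_ge0 => x _; rewrite lee_fin sqr_ge0. Qed.

Lemma dyadic_energy_term_ge0 n k u :
  0 <= ((2 ^+ n) ^+ d * dyadic_coef n k u ^+ 2)%:E.
Proof. by rewrite lee_fin mulr_ge0 ?sqr_ge0// !exprn_ge0. Qed.

Lemma dyadic_energy_ge0 n u : 0 <= dyadic_energy n u.
Proof. by apply: esum_ge0 => k _; exact: dyadic_energy_term_ge0. Qed.

Lemma measurable_sqr u : measurable_fun setT u ->
  measurable_fun setT (fun x => ((u x) ^+ 2)%:E).
Proof. by move=> mu_; apply/measurable_EFinP/measurable_funX. Qed.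

Lemma integrable_sqr u : square_integrable u ->
  mu.-integrable setT (EFin \o (fun x => u x ^+ 2)%R).
Proof.
move=> [mu_ uoo]; apply/integrableP; split; first exact: measurable_sqr.
rewrite (eq_integral (fun x => (u x ^+ 2)%:E))// => x _.
by rewrite /= ger0_norm// sqr_ge0.
Qed.

Lemma integrable_indic_sqr n k u : square_integrable u ->
  mu.-integrable setT (EFin \o (fun x => \1_(dyadic n k) x * u x ^+ 2)%R).
Proof.
move=> /integrable_sqr ui.
apply: (eq_integrable measurableT
  ((EFin \o \1_(dyadic n k)) \* (EFin \o (fun x => u x ^+ 2)%R))).
  by move=> x _; rewrite /= EFinM.
apply: integrableMr => //; first by apply: measurable_indic; exact: measurable_dyadic.
exists 1%R; split; rewrite ?num_real// => M M1 x _.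
by apply: le_trans (ltW M1); rewrite indicE; case: (_ \in _); rewrite ?normr1 ?normr0.
Qed.

Lemma integrable_indic_L2 n k u : square_integrable u ->
  mu.-integrable setT (EFin \o (fun x => \1_(dyadic n k) x * u x)%R).
Proof.
move=> u2; have [mu_ _] := u2.
apply: (@le_integrable _ _ _ mu setT _ _
  (fun x => (\1_(dyadic n k) x)%:E + (\1_(dyadic n k) x * u x ^+ 2)%:E)) => //.
- apply/measurable_EFinP/measurable_funM => //.
  by apply: measurable_indic; exact: measurable_dyadic.
- move=> x _; rewrite /= lee_fin indicE; case: (_ \in _); last by rewrite !mul0r normr0 addr0.
  rewrite !mul1r [leRHS]ger0_norm ?addr_ge0 ?sqr_ge0// -real_normK ?num_real//.
  (* From (|u| - 1)^2 >= 0 follows |u| <= 1 + u^2, which is integrable over a cube of finite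
     measure. *)
  have := normr_ge0 (u x); have := sqr_ge0 (`|u x| - 1)%R.
  by rewrite -[true%:R]/(1%R : R); move: `|u x|%R => t; nra.
- apply: integrableD => //; first exact: integrable_indic_dyadic.
  exact: integrable_indic_sqr.
Qed.

Lemma square_integrableD u v : square_integrable u -> square_integrable v ->
  square_integrable (u \+ v)%R.
Proof.
move=> u2 v2; have [mu_ _] := u2; have [mv _] := v2; split; first exact: measurable_funD.
have : mu.-integrable setT (fun x => (2 * u x ^+ 2)%:E + (2 * v x ^+ 2)%:E).
  by apply: integrableD => //; apply: integrable_EFinZl; exact: integrable_sqr.
move=> /integrableP[_]; apply: le_lt_trans.
apply: ge0_le_integral => //.
- by move=> x _; rewrite lee_fin sqr_ge0.
- by apply: measurable_sqr; exact: measurable_funD.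
- apply: measurableT_comp => //; apply/measurable_EFinP/measurable_funD;
  by apply: measurable_funM => //; exact: measurable_funX.
- move=> x _ /=; rewrite lee_fin ger0_norm.
    by have := sqr_ge0 (u x - v x)%R; nra.
  by rewrite addr_ge0// mulr_ge0// sqr_ge0.
Qed.

Lemma sqnormZ c u : measurable_fun setT u ->
  sqnorm (fun x => c * u x)%R = (c ^+ 2)%:E * sqnorm u.
Proof.
move=> mu_; rewrite -ge0_integralZl_EFin ?sqr_ge0//; last 2 first.
- by move=> x _; rewrite lee_fin sqr_ge0.
- exact: measurable_sqr.
by apply: eq_integral => x _; rewrite exprMn EFinM.
Qed.

Lemma square_integrableZ c u : square_integrable u ->
  square_integrable (fun x => c * u x)%R.
Proof.
move=> [mu_ uoo]; split; first exact: measurable_funM.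
by rewrite sqnormZ// lte_mul_pinfty// ?lee_fin ?sqr_ge0.
Qed.

Lemma square_integrableB u v : square_integrable u -> square_integrable v ->
  square_integrable (u \- v)%R.
Proof.
move=> u2 v2; rewrite (_ : (u \- v)%R = (u \+ (fun x => -1 * v x))%R).
  by apply: square_integrableD => //; exact: square_integrableZ.
by apply/funext => x /=; rewrite mulN1r.
Qed.

(** Subtracting the same law for the energies gives a parallelogram law for their difference, so no
    bilinear form is required. Doubling is written as a sum to stay within additions of nonnegative
    extended reals. *)
Lemma sqnorm_parallelogram u v :
  square_integrable u -> square_integrable v ->
  sqnorm (u \+ v)%R + sqnorm (u \- v)%R =
  (sqnorm u + sqnorm u) + (sqnorm v + sqnorm v).
Proof.
move=> [mu_ _] [mv _].
have ge0 (f : 'rV[R]_d -> R) x : setT x -> 0 <= ((f x) ^+ 2)%:E.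
  by move=> _; rewrite lee_fin sqr_ge0.
have ge0D (f : 'rV[R]_d -> R) x : setT x -> 0 <= ((f x) ^+ 2)%:E + ((f x) ^+ 2)%:E.
  by move=> _; rewrite adde_ge0// lee_fin sqr_ge0.
have ms (f : 'rV[R]_d -> R) : measurable_fun setT f ->
  measurable_fun setT (fun x => ((f x) ^+ 2)%:E) by exact: measurable_sqr.
have msD (f : 'rV[R]_d -> R) : measurable_fun setT f ->
    measurable_fun setT (fun x => ((f x) ^+ 2)%:E + ((f x) ^+ 2)%:E).
  by move=> /ms mf; exact: emeasurable_funD.
have DE (f g : 'rV[R]_d -> \bar R) : measurable_fun setT f ->
    measurable_fun setT g -> (forall x, setT x -> 0 <= f x) ->
    (forall x, setT x -> 0 <= g x) ->
    \int[mu]_x f x + \int[mu]_x g x = \int[mu]_x (f x + g x).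
  by move=> *; rewrite ge0_integralD.
have mD : measurable_fun setT (u \+ v)%R by exact: measurable_funD.
have mB : measurable_fun setT (u \- v)%R by exact: measurable_funB.
rewrite /sqnorm !DE; try exact: ms; try exact: msD; try exact: ge0; try exact: ge0D.
by apply: eq_integral => x _; rewrite -!EFinD; congr EFin => /=; ring.
Qed.

Lemma dyadic_coefD n k u v : square_integrable u -> square_integrable v ->
  dyadic_coef n k (u \+ v)%R = (dyadic_coef n k u + dyadic_coef n k v)%R.
Proof.
move=> u2 v2; rewrite /dyadic_coef -RintegralD//; try exact: integrable_indic_L2.
by apply: eq_Rintegral => x _ /=; rewrite mulrDr.
Qed.

Lemma dyadic_coefZ n k c u : square_integrable u ->
  dyadic_coef n k (fun x => c * u x)%R = (c * dyadic_coef n k u)%R.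
Proof.
move=> u2; rewrite /dyadic_coef -RintegralZl//; last exact: integrable_indic_L2.
by apply: eq_Rintegral => x _ /=; rewrite mulrCA.
Qed.

Lemma dyadic_coefB n k u v : square_integrable u -> square_integrable v ->
  dyadic_coef n k (u \- v)%R = (dyadic_coef n k u - dyadic_coef n k v)%R.
Proof.
move=> u2 v2; rewrite /dyadic_coef -RintegralB//; try exact: integrable_indic_L2.
by apply: eq_Rintegral => x _ /=; rewrite mulrBr.
Qed.

Lemma dyadic_energy_parallelogram n u v :
  square_integrable u -> square_integrable v ->
  dyadic_energy n (u \+ v)%R + dyadic_energy n (u \- v)%R =
  (dyadic_energy n u + dyadic_energy n u) + (dyadic_energy n v + dyadic_energy n v).
Proof.
move=> u2 v2; rewrite /dyadic_energy -!esumD;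
  try by move=> k _; rewrite ?adde_ge0 ?dyadic_energy_term_ge0.
apply: eq_esum => k _; rewrite dyadic_coefD// dyadic_coefB// -!EFinD; congr EFin.
by move: (_ ^+ d)%R => c; ring.
Qed.

Lemma dyadic_energyZ n c u : square_integrable u ->
  dyadic_energy n (fun x => c * u x)%R = (c ^+ 2)%:E * dyadic_energy n u.
Proof.
move=> u2; rewrite /dyadic_energy (esum_pickle (fun k => dyadic_energy_term_ge0 n k _)).
rewrite (esum_pickle (fun k => dyadic_energy_term_ge0 n k _)).
rewrite -nneseriesZl; last first.
  by move=> i _; case: pickle_inv => //= k; exact: dyadic_energy_term_ge0.
apply: eq_eseriesr => i _; case: pickle_inv => [k|] /=; last by rewrite mule0.
by rewrite dyadic_coefZ// exprMn mulrCA.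
Qed.

Lemma Rintegral_indic_dyadic n k :
  (\int[mu]_x (\1_(dyadic n k) x : R) = (2 ^+ n) ^- d)%R.
Proof. by rewrite /Rintegral integral_indic_dyadic. Qed.

Lemma dyadic_bessel_term n k u : square_integrable u ->
  ((2 ^+ n) ^+ d * dyadic_coef n k u ^+ 2)%:E <= \int[mu]_(x in dyadic n k) (u x ^+ 2)%:E.
Proof.
move=> u2; have ui := integrable_indic_L2 n k u2; have u2i := integrable_indic_sqr n k u2.
rewrite integral_mkcond.
rewrite (eq_integral (fun x => (\1_(dyadic n k) x * u x ^+ 2)%:E)); last first.
  by move=> x _; rewrite epatch_indic /= -EFinM mulrC.
have -> : \int[mu]_x (\1_(dyadic n k) x * u x ^+ 2)%:E =
    (\int[mu]_x (\1_(dyadic n k) x * u x ^+ 2)%R)%:E.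
  by rewrite fineK//; exact: integrable_fin_num.
rewrite lee_fin; set a := dyadic_coef n k u; set M : R := ((2 ^+ n) ^+ d)%R.
have M0 : (0 < M)%R by rewrite !exprn_gt0.
(* [M * a] is the mean of [u] over the cube; the inequality is the nonnegativity of the variance,
   expanded below. *)
have : (0 <= \int[mu]_x (\1_(dyadic n k) x * (u x - M * a) ^+ 2))%R.
  by apply: Rintegral_ge0 => x _; rewrite mulr_ge0// sqr_ge0.
have -> : (\int[mu]_x (\1_(dyadic n k) x * (u x - M * a) ^+ 2) =
    \int[mu]_x ((\1_(dyadic n k) x * u x ^+ 2) -
      (2 * M * a) * (\1_(dyadic n k) x * u x) + (M * a) ^+ 2 * \1_(dyadic n k) x))%R.
  by apply: eq_Rintegral => x _; ring.
have i1 := integrable_EFinZl (2 * M * a) ui.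
have i2 := integrable_EFinZl ((M * a) ^+ 2) (@integrable_indic_dyadic R d n k).
have i3 : mu.-integrable setT (EFin \o (fun x => \1_(dyadic n k) x * u x ^+ 2 -
    (2 * M * a) * (\1_(dyadic n k) x * u x))%R).
  exact: (integrableB measurableT u2i i1).
rewrite RintegralD// RintegralB// !RintegralZl//; last exact: integrable_indic_dyadic.
rewrite Rintegral_indic_dyadic -/M -/(dyadic_coef n k u) -/a.
suff -> : ((M * a) ^+ 2 * M^-1 = M * a ^+ 2)%R by lra.
by field; rewrite gt_eqF.
Qed.

Lemma dyadic_bessel n u : square_integrable u -> dyadic_energy n u <= sqnorm u.
Proof.
move=> u2; rewrite /sqnorm (integral_dyadic_partition n).
- by apply: le_esum => k _; exact: dyadic_bessel_term.
- by apply: measurable_sqr; have [] := u2.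
- by move=> x; rewrite lee_fin sqr_ge0.
Qed.

Lemma Rintegral_sum (I : Type) (r : seq I) (f : I -> 'rV[R]_d -> R) :
  (forall i, mu.-integrable setT (EFin \o f i)) ->
  (\int[mu]_x (\sum_(i <- r) f i x) = \sum_(i <- r) \int[mu]_x f i x)%R.
Proof.
move=> fi; have sumi s : mu.-integrable setT (EFin \o (fun x => \sum_(i <- s) f i x)%R).
  elim: s => [|i s IH].
    by under [X in _ \o X]eq_fun do rewrite big_nil; exact: integrable0.
  under [X in _ \o X]eq_fun do rewrite big_cons.
  exact: (integrableD measurableT (fi i) IH).
elim: r => [|i r IH].
  under eq_Rintegral do rewrite big_nil.
  by rewrite big_nil /Rintegral integral0.
under eq_Rintegral do rewrite big_cons.
by rewrite big_cons RintegralD// IH.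
Qed.

Lemma dyadic_coef_split n k u : square_integrable u ->
  dyadic_coef n k u = (\sum_w dyadic_coef n.+1 (k *+ 2 + cube_pt w) u)%R.
Proof.
move=> u2; rewrite /dyadic_coef -Rintegral_sum; last first.
  by move=> w; exact: integrable_indic_L2.
by apply: eq_Rintegral => x _; rewrite indic_dyadic_split mulr_suml.
Qed.

(** The wavelet energy at level [n]: the dilated wavelet of index [k] is 2^(nd/2) times the
    difference of the indicators of two children of the cube [k]. *)
Definition dyadic_detail s (g1 g2 : 'I_s -> 'rV[int]_d) n u : \bar R :=
  \sum_(l < s) \esum_(k in setT) ((2 ^+ n) ^+ d *
    (dyadic_coef n.+1 (k *+ 2 + g1 l) u - dyadic_coef n.+1 (k *+ 2 + g2 l) u) ^+ 2)%:E.

Lemma dyadic_detail_ge0 s (g1 g2 : 'I_s -> 'rV[int]_d) n u :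
  0 <= dyadic_detail g1 g2 n u.
Proof.
apply: sume_ge0 => l _; apply: esum_ge0 => k _.
by rewrite lee_fin mulr_ge0 ?sqr_ge0// !exprn_ge0.
Qed.

Lemma dyadic_energyS s (g1 g2 : 'I_s -> 'rV[int]_d) n u :
  enumerates_pairs g1 g2 -> square_integrable u ->
  dyadic_energy n.+1 u = dyadic_energy n u + dyadic_detail g1 g2 n u.
Proof.
move=> g12 u2; rewrite /dyadic_detail -esum_sum; last first.
  by move=> k l _ _; rewrite lee_fin mulr_ge0 ?sqr_ge0// !exprn_ge0.
rewrite /dyadic_energy -esumD; last 2 first.
- by move=> k _; exact: dyadic_energy_term_ge0.
- move=> k _; apply: sume_ge0 => l _.
  by rewrite lee_fin mulr_ge0 ?sqr_ge0// !exprn_ge0.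
rewrite esum_dyadic_child; last by move=> k; exact: dyadic_energy_term_ge0.
apply: eq_esum => k _; rewrite !sumEFin -EFinD; congr EFin.
rewrite (dyadic_coef_split n k u2) -mulr_sumr -mulr_sumr -mulrDr expr2.
under [X in (_ + X)%R]eq_bigr do rewrite expr2.
pose c w := dyadic_coef n.+1 (k *+ 2 + w)%R u.
(* The factor 2^d of the vertex identity turns the weight (2^n)^d of the parents into the weight
   (2^(n+1))^d of the children. *)
rewrite (sum_enum_pairs_sub g12 c c) mulrA; congr (_ * _)%R.
by rewrite exprS exprMn mulrC.
Qed.

(** The single term of index [k] already equals the measure of the cube. With Bessel's inequality
    the gap of this indicator is 0 at level [n]. *)
Lemma dyadic_energy_indic_dyadic n k :
  sqnorm (\1_(dyadic n k)) <= dyadic_energy n (\1_(dyadic n k)).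
Proof.
have sq x : (\1_(dyadic n k) x * \1_(dyadic n k) x = \1_(dyadic n k) x :> R)%R.
  by rewrite indicE; case: (_ \in _); rewrite ?mulr1 ?mulr0.
rewrite /sqnorm; under eq_integral do rewrite expr2 sq.
rewrite integral_indic_dyadic; apply: esum_ge.
exists [set k]; first by split => //; exact: finite_set1.
rewrite fsbig_set1.
rewrite lee_fin /dyadic_coef; under eq_Rintegral do rewrite sq.
rewrite Rintegral_indic_dyadic; have : (0 < (2 ^+ n) ^+ d :> R)%R by rewrite !exprn_gt0.
by move: ((2 ^+ n) ^+ d)%R => M M0; rewrite expr2 mulrA divff ?gt_eqF// mul1r.
Qed.

End energy.

(** * Density of dyadic step functions *)

Section density.
Context {R : realType}.
Variables (d s : nat) (g1 g2 : 'I_s -> 'rV[int]_d).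
Hypothesis g12 : enumerates_pairs g1 g2.
Implicit Types (x : 'rV[R]_d) (k : 'rV[int]_d) (n : nat) (u v : 'rV[R]_d -> R).
Implicit Types (A B : set 'rV[R]_d).
Notation mu := (@lebesgue_rV R d).

(* The squared distance from u to the functions that are constant on the
   dyadic cubes of level n. *)
Definition dyadic_gap n u : R := fine (sqnorm u) - fine (dyadic_energy n u).

Lemma sqnorm_fin u : square_integrable u -> sqnorm u \is a fin_num.
Proof. by move=> [_ uoo]; rewrite ge0_fin_numE ?sqnorm_ge0. Qed.

Lemma dyadic_energy_fin n u : square_integrable u ->
  dyadic_energy n u \is a fin_num.
Proof.
move=> u2; rewrite ge0_fin_numE ?dyadic_energy_ge0//.
by apply: le_lt_trans (dyadic_bessel n u2) _; have [] := u2.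
Qed.

Lemma dyadic_gap_ge0 n u : square_integrable u -> 0 <= dyadic_gap n u.
Proof.
move=> u2; rewrite subr_ge0 fine_le ?sqnorm_fin ?dyadic_energy_fin//.
exact: dyadic_bessel.
Qed.

Lemma dyadic_gap_le n u : dyadic_gap n u <= fine (sqnorm u).
Proof. by rewrite lerBlDr lerDl fine_ge0// dyadic_energy_ge0. Qed.

(** From one level to the next the energy grows by the nonnegative detail term; this brings the pair
    enumeration into the density argument. *)
Lemma dyadic_gap_nonincreasing u m n : square_integrable u -> (m <= n)%N ->
  dyadic_gap n u <= dyadic_gap m u.
Proof.
move=> u2 /subnKC <-; elim: (n - m)%N => [|p IH]; first by rewrite addn0.
apply: le_trans IH; rewrite lerB// addnS fine_le ?dyadic_energy_fin//.
by rewrite (dyadic_energyS _ g12)// leeDl// dyadic_detail_ge0.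
Qed.

(** The parallelogram law for the gap, with the nonnegative gap of [u \- v] dropped. *)
Lemma dyadic_gapD n u v : square_integrable u -> square_integrable v ->
  dyadic_gap n (u \+ v) <= 2 * dyadic_gap n u + 2 * dyadic_gap n v.
Proof.
move=> u2 v2; have D2 := square_integrableD u2 v2.
have B2 := square_integrableB u2 v2.
have := sqnorm_parallelogram u2 v2; have := dyadic_energy_parallelogram n u2 v2.
rewrite -(fineK (sqnorm_fin u2)) -(fineK (sqnorm_fin v2)) -(fineK (sqnorm_fin D2)).
rewrite -(fineK (sqnorm_fin B2)) -(fineK (dyadic_energy_fin n u2)).
rewrite -(fineK (dyadic_energy_fin n v2)) -(fineK (dyadic_energy_fin n D2)).
rewrite -(fineK (dyadic_energy_fin n B2)) -!EFinD => -[h1] [h2].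
by have := dyadic_gap_ge0 n B2; rewrite /dyadic_gap; lra.
Qed.

Lemma dyadic_gapZ n c u : square_integrable u ->
  dyadic_gap n (fun x => c * u x) = c ^+ 2 * dyadic_gap n u.
Proof.
move=> u2; have [mu_ _] := u2.
rewrite /dyadic_gap sqnormZ// dyadic_energyZ// !fineM ?sqnorm_fin ?dyadic_energy_fin//.
by rewrite mulrBr.
Qed.

(** One level with a small gap is enough, since the gap stays below that value at all finer
    levels. *)
Definition dyadic_limit u :=
  square_integrable u /\ forall e, 0 < e -> exists n, dyadic_gap n u < e.

Lemma dyadic_limitD u v : dyadic_limit u -> dyadic_limit v ->
  dyadic_limit (u \+ v).
Proof.
move=> [u2 ul] [v2 vl]; split; first exact: square_integrableD.
move=> e e0; have e40 : 0 < e / 4 by rewrite divr_gt0.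
have [n un] := ul _ e40; have [m vm] := vl _ e40.
exists (maxn n m); apply: le_lt_trans (dyadic_gapD _ u2 v2) _.
have := dyadic_gap_nonincreasing u2 (leq_maxl n m).
by have := dyadic_gap_nonincreasing v2 (leq_maxr n m); lra.
Qed.

Lemma dyadic_limitZ c u : dyadic_limit u -> dyadic_limit (fun x => c * u x).
Proof.
move=> [u2 ul]; split; first exact: square_integrableZ.
move=> e e0; have c0 : 0 < 1 + c ^+ 2 by rewrite ltr_pwDl// sqr_ge0.
have [n un] := ul _ (divr_gt0 e0 c0); exists n.
rewrite dyadic_gapZ//; move: un; rewrite ltr_pdivlMr//.
by have := dyadic_gap_ge0 n u2; nra.
Qed.

(** The gap of the error [u \- v] is at most its squared norm, uniformly in the level. The two
    quarters of [e] absorb the factors 2 of [dyadic_gapD]. *)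
Lemma dyadic_limit_closed u : square_integrable u ->
  (forall e, 0 < e -> exists2 v, dyadic_limit v & fine (sqnorm (u \- v)) < e) ->
  dyadic_limit u.
Proof.
move=> u2 ul; split => // e e0; have e40 : 0 < e / 4 by rewrite divr_gt0.
have [v [v2 vl] uv] := ul _ e40; have [n vn] := vl _ e40.
exists n; have -> : u = v \+ (u \- v) by apply/funext => x /=; rewrite addrC subrK.
apply: le_lt_trans (dyadic_gapD _ v2 (square_integrableB u2 v2)) _.
by have := dyadic_gap_le n (u \- v); lra.
Qed.

Lemma sqnorm_indic A : measurable A -> sqnorm (\1_A : _ -> R) = mu A.
Proof.
move=> mA; rewrite /sqnorm (eq_integral (fun x => (\1_A x)%:E)).
  by rewrite integral_indic// setIT.
by move=> x _; rewrite indicE; case: (_ \in _); rewrite ?expr1n ?expr0n.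
Qed.

Lemma square_integrable_indic A : measurable A -> (mu A < +oo)%E ->
  square_integrable (\1_A : _ -> R).
Proof.
by move=> mA Aoo; split; [exact: measurable_indic|rewrite sqnorm_indic].
Qed.

Lemma dyadic_limit_dyadic n k : dyadic_limit (\1_(dyadic n k)).
Proof.
have k2 : square_integrable (\1_(dyadic n k) : _ -> R).
  apply: square_integrable_indic; first exact: measurable_dyadic.
  by rewrite lebesgue_dyadic ltry.
split => // e e0; exists n; rewrite (le_lt_trans _ e0)// subr_le0.
by rewrite fine_le ?sqnorm_fin ?dyadic_energy_fin//; exact: dyadic_energy_indic_dyadic.
Qed.

Lemma dyadic_limit0 : dyadic_limit (fun=> 0).
Proof.
have -> : (fun=> 0) = (fun x => 0 * \1_(dyadic 0 0) x) :> ('rV[R]_d -> R).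
  by apply/funext => x; rewrite mul0r.
by apply: dyadic_limitZ; exact: dyadic_limit_dyadic.
Qed.

(** Finite partial unions are handled by addition; the squared L2 distance from their indicators to
    that of the union is the measure of the remainder, which tends to 0. *)
Lemma dyadic_limit_bigcup (F : (set 'rV[R]_d)^nat) :
  (forall i, measurable (F i)) -> trivIset setT F ->
  (mu (\bigcup_i F i) < +oo)%E -> (forall i, dyadic_limit (\1_(F i))) ->
  dyadic_limit (\1_(\bigcup_i F i)).
Proof.
move=> mF tF Foo Fl; set A := \bigcup_i F i.
have mA : measurable A by exact: bigcupT_measurable.
pose B m := \big[setU/set0]_(i < m) F i.
have mB m : measurable (B m) by exact: bigsetU_measurable.
have BA m : B m `<=` A by rewrite /B -bigcup_mkord => x [i _ Fx]; exists i.
have Boo m : (mu (B m) < +oo)%E.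
  by apply: le_lt_trans Foo; apply: le_measure; rewrite ?inE.
have Bl m : dyadic_limit (\1_(B m)).
  elim: m => [|m IH].
    rewrite /B big_ord0 (_ : \1_set0 = fun=> 0); first exact: dyadic_limit0.
    by apply/funext => x; rewrite indicE in_set0.
  have -> : \1_(B m.+1) = \1_(B m) \+ \1_(F m) :> ('rV[R]_d -> R).
    have BF : B m `&` F m = set0.
      rewrite /B -bigcup_mkord; apply/seteqP; split => // x [[i /= im Fi] Fm].
      have imE : i = m by apply: (tF i m) => //; exists x.
      by rewrite imE ltnn in im.
    rewrite [B _]big_ord_recr/= -/(B m); apply/funext => x /=; rewrite !indicE in_setU.
    have [xB|] := boolP (x \in B m); last by rewrite add0r.
    have [xF|] := boolP (x \in F m); last by rewrite addr0.
    by exfalso; have : set0 x by rewrite -BF; split; exact: set_mem.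
  exact: dyadic_limitD.
apply: dyadic_limit_closed; first exact: square_integrable_indic.
move=> e e0; have cB : (mu \o (fun n => B n.+1)) n @[n --> \oo] --> mu A.
  have BE : \bigcup_n B n.+1 = A by rewrite bigcup_bigsetU_bigcup.
  rewrite -BE; apply: nondecreasing_cvg_mu => //; first by rewrite BE.
  move=> m n mn; apply/subsetPset; rewrite /B -!bigcup_mkord => x [i im Fx].
  by exists i => //; exact: leq_trans im _.
have Afin : mu A \is a fin_num by rewrite ge0_fin_numE.
have := cB; rewrite -(fineK Afin) => /fine_cvg /cvgrPdist_lt /(_ _ e0) [p _ /(_ p)/=].
move=> /(_ (leqnn p)); set m := p.+1 => mB_; exists (\1_(B m)) => //.
have -> : \1_A \- \1_(B m) = \1_(A `\` B m) :> ('rV[R]_d -> R).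
  apply/funext => x /=; rewrite !indicE in_setD.
  have [xB|] := boolP (x \in B m); last by rewrite subr0 andbT.
  by rewrite andbF (_ : x \in A) ?subrr//; apply/mem_set/(BA m)/set_mem.
rewrite sqnorm_indic; last exact: measurableD.
rewrite measureD// setIidr// fineB ?ge0_fin_numE//; last exact: Boo.
by apply: le_lt_trans mB_; exact: ler_norm.
Qed.

(** Intersecting with a unit cube keeps every set of finite measure, so complements become
    differences of square-integrable indicators and the Dynkin induction goes through. *)
Lemma dyadic_limit_indic_unit A k : measurable A ->
  dyadic_limit (\1_(A `&` dyadic 0 k)).
Proof.
move=> mA; move: k.
have mS B : (@measurable _ 'rV[R]_d) B = <<s @dyadics R d >> B by rewrite measurable_dyadics.
rewrite mS in mA; move: A mA.
have fin k B : measurable B -> (mu (B `&` dyadic 0 k) < +oo)%E.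
  move=> mB; apply: le_lt_trans (_ : mu (dyadic 0 k) < +oo)%E.
    apply: le_measure; rewrite ?inE//; last exact: measurable_dyadic.
    by apply: measurableI => //; exact: measurable_dyadic.
  by rewrite lebesgue_dyadic ltry.
apply: (dynkin_induction
  (P := fun B => forall k, dyadic_limit (\1_(B `&` dyadic 0 k)))
  (@measurable_dyadics R d)).
- exact: setI_closed_dyadics.
- by move=> k; rewrite setTI; exact: dyadic_limit_dyadic.
- move=> B GB k; have : dyadics (B `&` dyadic 0 k).
    by apply: setI_closed_dyadics => //; right; exists 0, k.
  move=> [->|[n [l ->]]]; last exact: dyadic_limit_dyadic.
  rewrite (_ : \1_set0 = fun=> 0); first exact: dyadic_limit0.
  by apply/funext => x; rewrite indicE in_set0.
- move=> B mB Bl k; have -> : \1_(~` B `&` dyadic 0 k) =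
    \1_(dyadic 0 k) \+ (fun x => -1 * \1_(B `&` dyadic 0 k) x) :> ('rV[R]_d -> R).
    apply/funext => x /=; rewrite !indicE !in_setI in_setC.
    by case: (x \in B); case: (x \in dyadic 0 k) => /=; ring.
  by apply: dyadic_limitD; [exact: dyadic_limit_dyadic|exact: dyadic_limitZ].
- move=> F mF tF Fl k; rewrite setI_bigcupl; apply: dyadic_limit_bigcup.
  + by move=> i; apply: measurableI => //; exact: measurable_dyadic.
  + exact: trivIset_setIr.
  + by rewrite -setI_bigcupl; apply: fin; exact: bigcupT_measurable.
  + by move=> i; exact: Fl.
Qed.

Lemma dyadic_limit_indic A : measurable A -> (mu A < +oo)%E ->
  dyadic_limit (\1_A).
Proof.
move=> mA Aoo; have AE : A = \bigcup_i (A `&` dyadic_cover 0 i).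
  by rewrite -setI_bigcupr bigcup_dyadic_cover setIT.
rewrite AE; apply: dyadic_limit_bigcup.
- move=> i; apply: measurableI => //; rewrite /dyadic_cover.
  by case: pickle_inv => [k|]; [exact: measurable_dyadic|exact: measurable0].
- exact: (@trivIset_setIl _ _ _ _ (fun=> A) (@trivIset_dyadic_cover R d 0)).
- by rewrite -AE.
- move=> i; rewrite /dyadic_cover; case: pickle_inv => [k|].
    exact: dyadic_limit_indic_unit.
  rewrite setI0 (_ : \1_set0 = fun=> 0); first exact: dyadic_limit0.
  by apply/funext => x; rewrite indicE in_set0.
Qed.

Lemma dyadic_limit_sum (I : Type) (r : seq I) (u : I -> 'rV[R]_d -> R) :
  (forall i, dyadic_limit (u i)) -> dyadic_limit (fun x => \sum_(i <- r) u i x).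
Proof.
move=> ul; elim: r => [|i r IH].
  by under eq_fun do rewrite big_nil; exact: dyadic_limit0.
by under eq_fun do rewrite big_cons; exact: dyadic_limitD.
Qed.

Import HBNNSimple.

Lemma square_integrable_le u v : measurable_fun setT v ->
  (forall x, `|v x| <= `|u x|) -> square_integrable u -> square_integrable v.
Proof.
move=> mv vu [mu_ uoo]; split => //; apply: le_lt_trans uoo.
apply: ge0_le_integral => //.
- by move=> x _; rewrite lee_fin sqr_ge0.
- exact: measurable_sqr.
- exact: measurable_sqr.
- move=> x _; rewrite lee_fin -(real_normK (num_real (v x))) -(real_normK (num_real (u x))).
  by rewrite lerXn2r ?nnegrE.
Qed.

Lemma dyadic_limit_nnsfun (g : {nnsfun 'rV[R]_d >-> R}) :
  square_integrable g -> dyadic_limit g.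
Proof.
move=> g2'.
rewrite (_ : (g : _ -> R) = fun x => \sum_(y <- finmap.enum_fset (fset_set (range g)))
    (y * \1_(g @^-1` [set y]) x)); last first.
  by apply/funext => x; rewrite fimfunE fsbig_finite.
apply: dyadic_limit_sum => y.
(* The level set of 0 may have infinite measure, but its term vanishes. For y != 0 the term is
   dominated by [g], which makes its level set of finite measure. *)
have [->|y0] := eqVneq y 0.
  by under eq_fun do rewrite mul0r; exact: dyadic_limit0.
apply: dyadic_limitZ; have my : measurable (g @^-1` [set y]) by exact: measurable_sfunP.
apply: dyadic_limit_indic => //.
have [_] : square_integrable (fun x => y^-1 * (y * \1_(g @^-1` [set y]) x)).
  apply: square_integrableZ; apply: (square_integrable_le _ _ g2').
    by apply: measurable_funM => //; exact: measurable_indic.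
  move=> x; rewrite indicE; have [/set_mem/= ->|_] := boolP (x \in _); first by rewrite mulr1.
  by rewrite mulr0 normr0.
rewrite (_ : (fun x => _) = \1_(g @^-1` [set y])) ?sqnorm_indic//.
by apply/funext => x; rewrite mulKf.
Qed.

Lemma dyadic_limit_nonneg u : (forall x, 0 <= u x) -> square_integrable u ->
  dyadic_limit u.
Proof.
move=> u0 u2; have [mu_ uoo] := u2.
have mEu : measurable_fun setT (EFin \o u) by exact/measurable_EFinP.
pose g n : {nnsfun 'rV[R]_d >-> R} := nnsfun_approx measurableT mEu n.
have gu n x : g n x <= u x.
  by rewrite -lee_fin /g nnsfun_approxE;
    apply: (le_approx (f := EFin \o u)) => // y _; rewrite lee_fin.
have g0 n x : 0 <= g n x by [].
have gl n : dyadic_limit (g n).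
  apply: dyadic_limit_nnsfun; apply: (square_integrable_le _ _ u2) => // x.
  by rewrite !ger0_norm.
have cg x : g n x @[n --> \oo] --> u x.
  have := @cvg_nnsfun_approx _ _ _ _ measurableT _ mEu
    (fun y _ => u0 y : (0 <= (u y)%:E)%E) x Logic.I.
  by move=> /fine_cvg.
(* Since 0 <= [g n] <= [u], the squared error is dominated by u^2. *)
have [|||||_ _ cv] := @dominated_convergence _ _ _ mu setT measurableT
  (fun n x => ((u x - g n x) ^+ 2)%:E) (fun=> 0%E) (EFin \o (fun x => u x ^+ 2)%R).
- by move=> n; apply: measurable_sqr; exact: measurable_funB.
- exact: measurable_cst.
- apply: aeW => x _; apply: cvg_EFin; first exact: nearW.
  have cB : u x - g n x @[n --> \oo] --> u x - u x by apply: cvgB => //; exact: cvg_cst.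
  by have := cvgM cB cB; rewrite subrr mulr0; apply.
- exact: integrable_sqr.
- apply: aeW => x n _; rewrite /= ger0_norm ?sqr_ge0// lee_fin.
  by have := gu n x; have := g0 n x; nra.
apply: dyadic_limit_closed => // e e0.
rewrite integral0 in cv.
have [n _ /(_ n (leqnn n))/=] := (cvgrPdist_lt _ _).1 (fine_cvg cv) _ e0.
rewrite sub0r normrN ger0_norm; last exact: fine_ge0 (sqnorm_ge0 _).
by exists (g n).
Qed.

Lemma dyadic_limit_L2 u : square_integrable u -> dyadic_limit u.
Proof.
move=> u2; have [mu_ _] := u2.
have -> : u = u^\+ \+ (fun x => -1 * u^\- x).
  by apply/funext => x /=; rewrite mulN1r -[in LHS](funrposBneg u).
apply: dyadic_limitD; last apply: dyadic_limitZ.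
all: apply: dyadic_limit_nonneg; first by move=> x; rewrite ?funrpos_ge0 ?funrneg_ge0.
all: apply: (square_integrable_le _ _ u2); first by
  [exact: measurable_funrpos|exact: measurable_funrneg].
all: move=> x; rewrite ger0_norm ?funrpos_ge0 ?funrneg_ge0//.
all: rewrite -[leRHS]/((Num.norm \o u) x) -funrposDneg /=.
  by rewrite lerDl funrneg_ge0.
by rewrite lerDr funrpos_ge0.
Qed.

Lemma cvg_dyadic_energy u : square_integrable u ->
  dyadic_energy n u @[n --> \oo] --> sqnorm u.
Proof.
move=> u2; have [_ ul] := dyadic_limit_L2 u2.
rewrite -(fineK (sqnorm_fin u2)); apply: cvg_EFin.
  by apply: nearW => n; exact: dyadic_energy_fin.
apply/cvgrPdist_lt => e e0; have [n un] := ul _ e0.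
exists n => // m /= nm; rewrite -/(dyadic_gap m u) ger0_norm ?dyadic_gap_ge0//.
exact: le_lt_trans (dyadic_gap_nonincreasing u2 nm) un.
Qed.

Lemma dyadic_energy_series u : square_integrable u ->
  (sqnorm u = dyadic_energy 0 u + \sum_(0 <= j <oo) dyadic_detail g1 g2 j u)%E.
Proof.
move=> u2; apply: (cvg_unique _ (cvg_dyadic_energy u2)); first exact: ereal_hausdorff.
have -> : (fun n => dyadic_energy n u) = (fun n => dyadic_energy 0 u +
    \sum_(0 <= j < n) dyadic_detail g1 g2 j u)%E.
  apply/funext; elim=> [|n IH]; first by rewrite big_geq// adde0.
  by rewrite (dyadic_energyS _ g12)// IH big_nat_recr//= addeA.
apply: cvgeD.
- rewrite ge0_adde_def// inE; first exact: dyadic_energy_ge0.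
  by apply: nneseries_ge0 => j _ _; exact: dyadic_detail_ge0.
- exact: cvg_cst.
- by apply: is_cvg_nneseries => j _ _; exact: dyadic_detail_ge0.
Qed.

End density.

(** * The tight framelet *)

Section framelet.
Context {R : realType}.
Variable d : nat.
Implicit Types (x : 'rV[R]_d) (k l : 'rV[int]_d) (n : nat).
Implicit Types (f : 'rV[R]_d -> R[i]) (h : 'rV[R]_d -> R).
Notation mu := (@lebesgue_rV R d).

Lemma sqr_normc (z : R[i]) :
  ComplexField.Normc.normc z ^+ 2 = complex.Re z ^+ 2 + complex.Im z ^+ 2.
Proof. by case: z => a b /=; rewrite sqr_sqrtr// addr_ge0 ?sqr_ge0. Qed.

Lemma norm2sqE f : cmeasurable f ->
  norm2sq f = (sqnorm (fun x => complex.Re (f x)) +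
               sqnorm (fun x => complex.Im (f x)))%E.
Proof.
move=> [mr mi]; rewrite /norm2sq /sqnorm -ge0_integralD//.
- by apply: eq_integral => x _; rewrite sqr_normc EFinD.
- by move=> x _; rewrite lee_fin sqr_ge0.
- exact: measurable_sqr.
- by move=> x _; rewrite lee_fin sqr_ge0.
- exact: measurable_sqr.
Qed.

Lemma in_L2P f : in_L2 f <->
  square_integrable (fun x => complex.Re (f x)) /\
  square_integrable (fun x => complex.Im (f x)).
Proof.
split=> [[mf]|[[mr rl] [mi il]]].
  have [mr mi] := mf; rewrite norm2sqE// => foo; split; split=> //;
    apply: le_lt_trans foo; rewrite ?leeDl ?leeDr ?sqnorm_ge0//.
by split; [split|rewrite norm2sqE// lte_add_pinfty].
Qed.

Lemma haar_scaling_dilate n k x :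
  haar_scaling (2 ^+ n *: x - toRd R k) = (\1_(dyadic n k) x)%:C.
Proof.
rewrite /haar_scaling !indicE !in_dyadic dyadic_index_dilate subr_eq add0r.
by rewrite addn0 expn0 mulr1n.
Qed.

Lemma haar_wavelet_dilate n k l1 l2 x :
  haar_wavelet l1 l2 (2 ^+ n *: x - toRd R k) =
  (\1_(dyadic n.+1 (k *+ 2 + l1)) x - \1_(dyadic n.+1 (k *+ 2 + l2)) x)%:C.
Proof.
rewrite /haar_wavelet !haar_scaling_refine rmorphB.
by rewrite !indicE !in_dyadic !dyadic_index_dilate !subr_eq !addn1 ![_ + k *+ _]addrC.
Qed.

Lemma in_L2_haar_scaling : in_L2 (@haar_scaling R d).
Proof.
apply/in_L2P; split.
  apply: square_integrable_indic; first exact: measurable_dyadic.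
  by rewrite lebesgue_dyadic ltry.
rewrite (_ : (fun x => _) = (fun x => 0 * \1_(dyadic 0 0) x)).
  apply/square_integrableZ/square_integrable_indic; first exact: measurable_dyadic.
  by rewrite lebesgue_dyadic ltry.
by apply/funext => x; rewrite mul0r.
Qed.

Lemma in_L2_haar_wavelet l1 l2 : in_L2 (@haar_wavelet R d l1 l2).
Proof.
have l2int l : square_integrable (\1_(dyadic 1 l) : 'rV[R]_d -> R).
  apply: square_integrable_indic; first exact: measurable_dyadic.
  by rewrite lebesgue_dyadic ltry.
have wE x : haar_wavelet l1 l2 x = (\1_(dyadic 1 l1) x - \1_(dyadic 1 l2) x)%:C.
  by rewrite /haar_wavelet !haar_scaling_refine rmorphB.
apply/in_L2P; split.
  by under eq_fun do rewrite wE /=; exact: square_integrableB.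
rewrite (_ : (fun x => _) = (fun x => 0 * \1_(dyadic 1 l1) x)).
  exact: square_integrableZ.
by apply/funext => x; rewrite wE mul0r.
Qed.

(** Against a real [h] the real and imaginary parts of [f] decouple, which reduces the framelet
    identity to real functions. *)
Lemma sqr_normc_inner_real f h :
  ComplexField.Normc.normc (inner f (fun x => (h x)%:C)) ^+ 2 =
  (\int[mu]_x (h x * complex.Re (f x))) ^+ 2 +
  (\int[mu]_x (h x * complex.Im (f x))) ^+ 2.
Proof.
rewrite sqr_normc /=; congr (_ ^+ 2 + _ ^+ 2); apply: eq_Rintegral => x _.
  by rewrite complex_ReM /= oppr0 mulr0 subr0 mulrC.
by rewrite complex_ImM /= oppr0 mulr0 add0r mulrC.
Qed.

(** The squared L2 normalisation is the weight 1/|Q| of [dyadic_energy]. *)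
Lemma sqr_dilation_factor n : (2 `^ ((n * d)%:R / 2)) ^+ 2 = (2 ^+ n) ^+ d :> R.
Proof.
by rewrite -powR_mulrn ?powR_ge0// -powRrM divfK ?pnatr_eq0// powR_mulrn// exprM.
Qed.

Lemma sqr_inner_haar_scaling f n k : in_L2 f ->
  ComplexField.Normc.normc (inner f (dilate_shift (@haar_scaling R d) n k)) ^+ 2 =
  (2 ^+ n) ^+ d * dyadic_coef n k (fun x => complex.Re (f x)) ^+ 2 +
  (2 ^+ n) ^+ d * dyadic_coef n k (fun x => complex.Im (f x)) ^+ 2.
Proof.
move=> /in_L2P[fr fi]; rewrite -sqr_dilation_factor.
rewrite (_ : dilate_shift _ n k =
    (fun x => (2 `^ ((n * d)%:R / 2) * \1_(dyadic n k) x)%:C)); last first.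
  by apply/funext => x; rewrite /dilate_shift haar_scaling_dilate -[LHS]rmorphM.
rewrite sqr_normc_inner_real -!exprMn -!dyadic_coefZ//.
by congr (_ ^+ 2 + _ ^+ 2); apply: eq_Rintegral => x _; ring.
Qed.

Lemma sqr_inner_haar_wavelet f n k l1 l2 : in_L2 f ->
  ComplexField.Normc.normc (inner f (dilate_shift (@haar_wavelet R d l1 l2) n k)) ^+ 2 =
  (2 ^+ n) ^+ d * (dyadic_coef n.+1 (k *+ 2 + l1) (fun x => complex.Re (f x)) -
    dyadic_coef n.+1 (k *+ 2 + l2) (fun x => complex.Re (f x))) ^+ 2 +
  (2 ^+ n) ^+ d * (dyadic_coef n.+1 (k *+ 2 + l1) (fun x => complex.Im (f x)) -
    dyadic_coef n.+1 (k *+ 2 + l2) (fun x => complex.Im (f x))) ^+ 2.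
Proof.
move=> /in_L2P[fr fi]; rewrite -sqr_dilation_factor.
set c := 2 `^ _; rewrite (_ : dilate_shift _ n k =
    (fun x => (c * (\1_(dyadic n.+1 (k *+ 2 + l1)) x -
                    \1_(dyadic n.+1 (k *+ 2 + l2)) x))%:C)); last first.
  by apply/funext => x; rewrite /dilate_shift haar_wavelet_dilate -[LHS]rmorphM.
rewrite sqr_normc_inner_real -!exprMn.
have coefE (u : 'rV[R]_d -> R) : square_integrable u ->
    \int[mu]_x (c * (\1_(dyadic n.+1 (k *+ 2 + l1)) x -
                    \1_(dyadic n.+1 (k *+ 2 + l2)) x) * u x) =
    c * (dyadic_coef n.+1 (k *+ 2 + l1) u - dyadic_coef n.+1 (k *+ 2 + l2) u).
  move=> u2; have i1 := integrable_indic_L2 n.+1 (k *+ 2 + l1) u2.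
  have i2 := integrable_indic_L2 n.+1 (k *+ 2 + l2) u2.
  rewrite /dyadic_coef -RintegralB// -RintegralZl//; last exact: (integrableB _ i1 i2).
  by apply: eq_Rintegral => x _; ring.
by rewrite !coefE.
Qed.

Lemma haar_tight_framelet s (g1 g2 : 'I_s -> 'rV[int]_d) :
  enumerates_pairs g1 g2 ->
  tight_framelet (@haar_scaling R d) (fun l : 'I_s => haar_wavelet (g1 l) (g2 l)).
Proof.
move=> g12; split; first exact: in_L2_haar_scaling.
  by move=> l; exact: in_L2_haar_wavelet.
move=> f f2; have /in_L2P[fr fi] := f2; have [mf _] := f2.
rewrite norm2sqE//; set u := (fun x => complex.Re (f x)); set v := (fun x => complex.Im (f x)).
rewrite (dyadic_energy_series g12 fr) (dyadic_energy_series g12 fi).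
rewrite addeACA; congr (_ + _)%E.
  rewrite /dyadic_energy -esumD; try by move=> k _; exact: dyadic_energy_term_ge0.
  apply: eq_esum => k _.
  (* The translates are the level-0 dilates, whose normalising factor is 1. *)
  have -> : translate (@haar_scaling R d) k = dilate_shift (@haar_scaling R d) 0 k.
    apply/funext => x; rewrite /translate /dilate_shift mul0n mul0r powRr0 expr0.
    by rewrite scale1r mul1r.
  by rewrite sqr_inner_haar_scaling// EFinD.
rewrite -nneseriesD; try by move=> j _ _; exact: dyadic_detail_ge0.
apply: eq_eseriesr => j _; rewrite /dyadic_detail -big_split /=.
apply: eq_bigr => l _; rewrite -esumD.
- by apply: eq_esum => k _; rewrite sqr_inner_haar_wavelet// EFinD.
- by move=> k _; rewrite lee_fin mulr_ge0 ?sqr_ge0// !exprn_ge0.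
- by move=> k _; rewrite lee_fin mulr_ge0 ?sqr_ge0// !exprn_ge0.
Qed.

End framelet.

Theorem theorem1 (R : realType) (d : nat) (d_ge1 : (1 <= d)%N)
    (s : nat) (s_def : s = 'C(2 ^ d, 2))
    (g1 g2 : 'I_s -> 'rV[int]_d) (g_pairs : enumerates_pairs g1 g2) :
  let aH := haar_lowpass R d in
  let b := fun l : 'I_s => haar_highpass R (g1 l) (g2 l) in
  [/\ tight_framelet_filter_bank aH b,
      (forall l, has_directionality (b l)) /\
        (directions b #= `I_((3 ^ d - 1) %/ 2))%card &
      exists (phi : 'rV[R]_d -> R[i]) (psi : 'I_s -> 'rV[R]_d -> R[i]),
        [/\ (forall xi : 'rV[R]_d,
               (fun n => \prod_(1 <= j < n.+1)
                  fourier_series aH ((2 ^+ j)^-1 *: xi) : R[i]^o) @ \oo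
               --> (fourier phi xi : R[i]^o)),
            (forall l (xi : 'rV[R]_d),
               fourier (psi l) xi =
               fourier_series (b l) (2^-1 *: xi) * fourier phi (2^-1 *: xi)),
            compactly_supported phi,
            (forall l, compactly_supported (psi l)) &
            tight_framelet phi psi]].
Proof.
have [gc _] := g_pairs; split.
- exact: haar_filter_bank.
- split; last exact: card_haar_directions.
  by move=> l; have [_ _] := gc l; exact: haar_has_directionality.
exists (@haar_scaling R d), (fun l : 'I_s => haar_wavelet (g1 l) (g2 l)); split.
- exact: haar_infinite_product.
- by move=> l xi; have [? ? _] := gc l; exact: fourier_haar_wavelet.
- exact: compactly_supported_haar_scaling.
- by move=> l; have [? ? _] := gc l; exact: compactly_supported_haar_wavelet.
- exact: haar_tight_framelet.
Qed.
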